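(* Let $T$ be a tree with at least two vertices such that $d:=\operatorname{dist}_T(\mathcal S(T),\mathcal C(T))>0$. Choose $s\in\mathcal S(T)$ and $c\in\mathcal C(T)$ with $d_T(s,c)=d$, let $B$ be the connected component of $T-s$ containing $c$, and put $m:=|V(B)|$. Let $\widehat T$ be the pathification of $T$ at $(s,c)$, i.e. the tree obtained from $T$ by deleting $B$ and attaching to $s$ a new path $s-y_1-y_2-\cdots-y_m$ (with $m$ new vertices $y_1,\dots,y_m$). Then \[ \operatorname{dist}_{\widehat T}\bigl(\mathcal S(\widehat T),\mathcal C(\widehat T)\bigr)\ \ge\ \operatorname{dist}_{T}\bigl(\mathcal S(T),\mathcal C(T)\bigr). \]
   Context: All graphs are finite, simple and undirected. For a tree $T$ with at least two vertices, $\lambda_1(T)\ge\lambda_2(T)\ge\cdots$ are the eigenvalues of its adjacency matrix $A(T)$ and $0=\mu_1(T)<\mu_2(T)\le\cdots$ those of its Laplacian $L(T)$. Adjacency spectral center: $\mathcal S(T)$ is (the vertex set of) the unique minimal subtree $Y$ of $T$ such that every connected component of $T-Y$ has adjacency spectral radius at most $\lambda_2(T)$. It is known that this is well defined and consists of either one vertex or the two endpoints of one edge. Characteristic set: let $f$ be a Fiedler vector of $T$, i.e. an eigenvector of $L(T)$ for $\mu_2(T)$. It is known that exactly one of the following happens: (1) some entry of $f$ is zero, and then there is a unique vertex $v$ with $f_v=0$ that is adjacent to a vertex $w$ with $f_w\ne0$; in this case $\mathcal C(T)=\{v\}$; (2) no entry of $f$ is zero, and then there is a unique edge $uv$ with $f_u>0>f_v$;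 in this case $\mathcal C(T)=\{u,v\}$ (a characteristic edge). The set $\mathcal C(T)$ does not depend on the choice of $f$. For nonempty $X,Y\subseteq V(T)$, $\operatorname{dist}_T(X,Y):=\min\{d_T(x,y):x\in X,y\in Y\}$, where $d_T$ is the graph distance. *)

(* Defs.v *)
From HB Require Import structures.
From mathcomp Require Import all_boot all_order all_algebra.
From mathcomp Require Import reals polyrcf.

Set Implicit Arguments.
Unset Strict Implicit.
Unset Printing Implicit Defensive.

Import Order.TTheory GRing.Theory Num.Theory.

Local Open Scope ring_scope.

(* A graph is an edge relation [e : rel V] on a [V : finType]. *)
Section Graphs.
Variables (V : finType) (e : rel V).

Definition simple_graph := symmetric e /\ irreflexive e.

Definition connected_graph := forall x y, connect e x y.

(* A cycle of a simple graph has at least three vertices; [cycle e [:: x; y]]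
   holds for every edge xy. *)
Definition acyclic_graph := forall p : seq V, (2 < size p)%N -> ~ ucycle e p.

Definition is_tree := [/\ simple_graph, connected_graph & acyclic_graph].

Definition restr (X : {set V}) : rel V :=
  [rel x y | [&& x \in X, y \in X & e x y]].

(* In a tree, the subtrees are the nonempty sets inducing a connected graph. *)
Definition is_subtree (Y : {set V}) : bool :=
  (Y != set0) && [forall x in Y, forall y in Y, connect (restr Y) x y].

(* Vertex set of the component of x in the graph minus Y, for x \notin Y. *)
Definition component (Y : {set V}) (x : V) : {set V} :=
  [set y | connect (restr (~: Y)) x y].

(* Smallest length of a walk from x to y; #|V| if there is none. *)
Definition gdist (x y : V) : nat :=
  \big[minn/#|V|]_(n < #|V| |
    [exists p : n.-tuple V, path e x p && (last x p == y)]) (n : nat).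

(* In a connected graph all distances are smaller than #|V|, so the default
   value matters only when X or Y is empty. *)
Definition setdist (X Y : {set V}) : nat :=
  \big[minn/#|V|]_(x in X) \big[minn/#|V|]_(y in Y) gdist x y.

(* Pathification at (s, c): [inr i] is the new vertex y_(i+1). *)
Definition branch (s c : V) : {set V} := component [set s] c.

Definition pathif_vertex (s c : V) : finType :=
  ({x : V | x \notin branch s c} + 'I_#|branch s c|)%type.

Definition pathif (s c : V) : rel (pathif_vertex s c) := fun u v =>
  match u, v with
  | inl x, inl y => e (val x) (val y)
  | inl x, inr i | inr i, inl x => (val x == s) && (i == 0 :> nat)
  | inr i, inr j => (i.+1 == j :> nat) || (j.+1 == i :> nat)
  end.

End Graphs.

Arguments pathif {V} e s c _ _.

Section Eigenvalues.
Variables (R : realType) (n : nat).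
Implicit Type A : 'M[R]_n.

(* Real eigenvalues with multiplicity, in increasing order; all matrices
   considered below are symmetric, so these are all the eigenvalues. *)
Definition spectrum A : seq R :=
  sort <=%R (flatten [seq nseq (mup x (char_poly A)) x
                     | x <- rootsR (char_poly A)]).

Definition spectral_radius A : R :=
  \big[Num.max/0]_(a <- spectrum A) `|a|.

End Eigenvalues.

Section SpectralGraph.
Variables (R : realType) (V : finType) (e : rel V).

Definition adjmx : 'M[R]_#|V| :=
  \matrix_(i, j) (e (enum_val i) (enum_val j))%:R.

Definition degree (x : V) : nat := #|[set y | e x y]|.

Definition lapmx : 'M[R]_#|V| :=
  diag_mx (\row_i (degree (enum_val i))%:R) - adjmx.

(* Second largest adjacency eigenvalue and second smallest Laplacian one. *)
Definition lambda2 : R := nth 0 (rev (spectrum adjmx)) 1.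
Definition mu2 : R := nth 0 (spectrum lapmx) 1.

Definition fiedler (f : 'cV[R]_#|V|) : Prop :=
  f != 0 /\ lapmx *m f = mu2 *: f.

Definition entry (f : 'cV[R]_#|V|) (x : V) : R := f (enum_rank x) 0.

(* Both alternatives are stated without the uniqueness of v, resp. of uv,
   which is a theorem for trees. *)
Definition charset_of (f : 'cV[R]_#|V|) (C : {set V}) : Prop :=
  ((exists x, entry f x = 0) /\
   exists v w, [/\ e v w, entry f v = 0, entry f w <> 0 & C = [set v]])
  \/
  ((forall x, entry f x <> 0) /\
   exists u v, [/\ e u v, 0 < entry f u, entry f v < 0 & C = [set u; v]]).

Definition charset (C : {set V}) : Prop :=
  exists2 f, fiedler f & charset_of f C.

End SpectralGraph.

Section SpectralCenter.
Variables (R : realType) (V : finType) (e : rel V).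

Definition induced_radius (X : {set V}) : R :=
  spectral_radius (adjmx R (relpre (val : {x : V | x \in X} -> V) e)).

(* Deleting Y leaves components of spectral radius at most lambda2. *)
Definition splitting_subtree (Y : {set V}) : bool :=
  is_subtree e Y &&
  [forall x, (x \notin Y) ==> (induced_radius (component e Y x) <= lambda2 R e)].

Definition spectral_center (S : {set V}) : Prop := minset splitting_subtree S.

End SpectralCenter.

(* Main.v *)
Require Import Defs.
From mathcomp Require Import all_boot all_order all_algebra.
From mathcomp Require Import perm reals polyrcf complex ring lra zify.

Set Implicit Arguments.
Unset Strict Implicit.
Unset Printing Implicit Defensive.

Import Order.TTheory GRing.Theory Num.Theory.

Local Open Scope ring_scope.

(** All eigenvalue comparisons are made with test vectors. Write d for the distance
    and root the tree at s.

    Laplacian side. A vector z on the part of the pathified tree before y_d can be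
    transplanted to T with the same energy and no smaller norm, by pulling it back
    along the projection of T onto the path from s to c. The negative part k of a
    Fiedler vector on the descendants of c has Rayleigh quotient at most mu_2(T), and
    its running maximum along an enumeration by depth is a vector on the path after
    y_d with no larger energy and no smaller norm. Since two nonadjacent test vectors
    bound mu_2 from above, the Dirichlet eigenvalue of the part before y_d is at least
    mu_2 of the pathified tree; a Perron argument then shows that its Fiedler vectors
    have no sign change before y_d, so its characteristic set lies in {y_d, ..., y_m}.

    Adjacency side. Among connected graphs with m vertices the path minimizes the
    spectral radius (a zigzag rearrangement of a path vector along a tree), so the new
    path has spectral radius at most that of B, hence at most lambda_2(T); as s is a
    vertex of the spectral center, some vector on the rest of T reaches this value too,
    and the new path has spectral radius at most lambda_2 of the pathified tree. Then
    the old vertices contain the new spectral center: otherwise cutting that center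
    down to the old vertices would give a smaller splitting subtree, or an edge would
    separate the tree into two parts of spectral radius at most lambda_2, which is
    impossible. *)

(** * Diagonalization of real symmetric matrices *)

Section RealSpectral.
Variable R : rcfType.

Lemma dot_row_ge0 n (v : 'rV[R]_n) : 0 <= (v *m v^T) 0 0.
Proof. by rewrite mxE sumr_ge0 // => i _; rewrite mxE -expr2 sqr_ge0. Qed.

Lemma dot_row_eq0 n (v : 'rV[R]_n) : ((v *m v^T) 0 0 == 0) = (v == 0).
Proof.
apply/idP/eqP => [|->]; last by rewrite mul0mx mxE.
rewrite mxE psumr_eq0 => [/allP h|i _]; last by rewrite mxE -expr2 sqr_ge0.
apply/rowP => i; have := h i; rewrite mem_index_enum !mxE mulf_eq0 orbb => /(_ isT).
by move=> /eqP.
Qed.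

Lemma addmxE m n (A B : 'M[R]_(m, n)) i j : (A + B) i j = A i j + B i j.
Proof. by rewrite mxE. Qed.

Lemma oppmxE m n (A : 'M[R]_(m, n)) i j : (- A) i j = - A i j.
Proof. by rewrite mxE. Qed.

Lemma scalemxE m n a (A : 'M[R]_(m, n)) i j : (a *: A) i j = a * A i j.
Proof. by rewrite mxE. Qed.

Lemma sym_eigenvector n (A : 'M[R]_n.+1) : A^T = A ->
  exists a (v : 'rV_n.+1), v != 0 /\ v *m A = a *: v.
Proof.
move=> symA; pose toC := real_complex R : R -> R[i].
have [[a b] /eigenvalueP [w wE w0]] :=
  @eigenvalue_closed R[i] n.+1 (map_mx toC A) isT.
pose x := map_mx (@complex.Re R) w; pose y := map_mx (@complex.Im R) w.
have xE : x *m A = a *: x - b *: y.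
  apply/rowP => j; have /rowP/(_ j) := wE; rewrite !mxE.
  move=> /(congr1 (@complex.Re R)); case E : (w 0 j) => [p q] /= <-.
  rewrite (big_morph (@complex.Re R) (id1 := 0) (op1 := +%R)) //; last by case=> ? ? [].
  by apply: eq_bigr => k _; rewrite !mxE /=; case: (w 0 k) => ? ? /=; ring.
have yE : y *m A = b *: x + a *: y.
  apply/rowP => j; have /rowP/(_ j) := wE; rewrite !mxE.
  move=> /(congr1 (@complex.Im R)); case E : (w 0 j) => [p q] /=.
  rewrite addrC => <-.
  rewrite (big_morph (@complex.Im R) (id1 := 0) (op1 := +%R)) //; last by case=> ? ? [].
  by apply: eq_bigr => k _; rewrite !mxE /=; case: (w 0 k) => ? ? /=; ring.
have xy0 : ~~ ((x == 0) && (y == 0)).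
  apply: contra w0 => /andP [/eqP x0 /eqP y0]; apply/eqP/rowP => j.
  have /rowP/(_ j) := x0; have /rowP/(_ j) := y0; rewrite !mxE.
  by case: (w 0 j) => p q /= -> ->.
have dxy : (x *m y^T) 0 0 = (y *m x^T) 0 0.
  by rewrite !mxE; apply: eq_bigr => k _; rewrite !mxE mulrC.
have b0 : b = 0.
  have h : (x *m A *m y^T) 0 0 = (y *m A *m x^T) 0 0.
    have <- : (y *m A *m x^T)^T = x *m A *m y^T.
      by rewrite !trmx_mul trmxK symA mulmxA.
    by rewrite mxE.
  move: h; rewrite xE yE mulmxBl mulmxDl -!scalemxAl !addmxE oppmxE !scalemxE dxy => h.
  have := dot_row_ge0 x; have := dot_row_ge0 y.
  have : b * ((x *m x^T) 0 0 + (y *m y^T) 0 0) = 0 by lra.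
  move/eqP; rewrite mulf_eq0 => /orP [/eqP //|/eqP s0 hy hx].
  move: xy0; rewrite -!dot_row_eq0.
  have -> : (x *m x^T) 0 0 = 0 by lra.
  have -> : (y *m y^T) 0 0 = 0 by lra.
  by rewrite eqxx.
move: xE yE; rewrite b0 !scale0r subr0 add0r => xE yE; exists a.
by move: xy0; rewrite negb_and => /orP []; [exists x|exists y].
Qed.

(* Q is the Householder reflection exchanging the first basis vector and v. *)
Lemma orthogonal_first_row n (v : 'rV[R]_n.+1) : (v *m v^T) 0 0 = 1 ->
  exists Q : 'M[R]_n.+1, Q *m Q^T = 1%:M /\ row 0 Q = v.
Proof.
move=> v1; pose e0 : 'rV[R]_n.+1 := delta_mx 0 0; pose w := e0 - v; pose r := (w *m w^T) 0 0.
have d1 : (e0 *m w^T) 0 0 = 1 - v 0 0.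
  rewrite mxE (bigD1 0) //= big1 => [|i /negPf i0]; rewrite !mxE ?eqxx ?i0 ?mul0r //=.
  by rewrite mul1r addr0.
have rE : r = 2 * (1 - v 0 0).
  rewrite /r {1}/w mulmxBl addmxE oppmxE d1 /w linearB /= mulmxBr addmxE oppmxE.
  by rewrite v1 trmx_delta -colE mxE; ring.
have [w0|w0] := eqVneq w 0.
  exists 1%:M; rewrite trmx1 mulmx1; split=> //.
  by rewrite row1 -/e0; apply/eqP; rewrite -subr_eq0 -/w w0.
have r0 : r != 0 by rewrite /r dot_row_eq0.
have ww : w *m w^T = r%:M by rewrite [LHS]mx11_scalar.
pose P := w^T *m w; pose Q := 1%:M - (2 / r) *: P.
have PP : P *m P = r *: P.
  by rewrite /P mulmxA -(mulmxA w^T w) ww mul_mx_scalar scalemxAl.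
have PT : P^T = P by rewrite /P trmx_mul trmxK.
exists Q; split.
  have -> : Q^T = Q.
    apply/matrixP => i j; have /matrixP/(_ i j) := PT; rewrite !mxE eq_sym.
    by move=> ->.
  rewrite /Q mulmxBl mul1mx mulmxBr mulmx1.
  rewrite -scalemxAl -scalemxAr PP !scalerA -addrA -opprD.
  rewrite -scaleNr -!scalerDl.
  suff -> : 2 / r + (2 / r - 2 / r * (2 / r) * r) = 0 by rewrite scale0r subr0.
  by field.
rewrite rowE -/e0 /Q mulmxBr mulmx1 -scalemxAr /P mulmxA [_ *m w^T]mx11_scalar d1.
rewrite mul_scalar_mx scalerA.
have -> : 2 / r * (1 - v 0 0) = 1 by rewrite mulrAC -rE divff.
by rewrite scale1r /w subKr.
Qed.

Lemma sym_orthogonal_diag n (A : 'M[R]_n) : A^T = A ->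
  exists (U : 'M[R]_n) (d : 'rV[R]_n), U *m U^T = 1%:M /\ U *m A = diag_mx d *m U.
Proof.
elim: n A => [|n IH] A symA.
  by exists 1%:M, 0; split; apply/matrixP => -[].
have [a [v0 [v0n v0E]]] := sym_eigenvector symA.
pose r := (v0 *m v0^T) 0 0; pose v := (Num.sqrt r)^-1 *: v0.
have r0 : 0 < r by rewrite lt_neqAle eq_sym dot_row_eq0 v0n dot_row_ge0.
have vE : v *m A = a *: v by rewrite /v -scalemxAl v0E !scalerA mulrC.
have v1 : (v *m v^T) 0 0 = 1.
  rewrite /v linearZ /= -scalemxAl -scalemxAr scalerA mxE -/r.
  by rewrite -invfM -expr2 sqr_sqrtr ?ltW // mulVf ?gt_eqF.
have [Q [QQ Q0]] := orthogonal_first_row v1.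
have [M MdE] : exists M : 'M[R]_(1 + n), M = Q *m A *m Q^T by exists (Q *m A *m Q^T).
have symM : M^T = M by rewrite MdE !trmx_mul trmxK symA mulmxA.
have rM : row 0 M = a *: delta_mx 0 0.
  by rewrite MdE !row_mul Q0 vE -scalemxAl -Q0 -row_mul QQ row1.
have M0 j : M 0 j = a * (j == 0)%:R.
  by have /rowP/(_ j) := rM; rewrite !mxE eqxx.
have ME : M = block_mx a%:M 0 0 (drsubmx M).
  rewrite -[LHS]submxK; congr block_mx.
  - apply/matrixP => i j; rewrite !mxE !ord1 lshift0 M0 eqxx.
    by rewrite mulr1.
  - apply/matrixP => i j; rewrite !mxE ord1 lshift0 M0 -val_eqE /=.
    by rewrite mulr0.
  - apply/matrixP => i j; rewrite !mxE ord1 -symM mxE lshift0 M0 -val_eqE /=.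
    by rewrite mulr0.
have symD : (drsubmx M)^T = drsubmx M by rewrite trmx_drsub symM.
have [U' [d' [U'1 U'E]]] := IH _ symD.
pose V : 'M[R]_(1 + n) := block_mx 1%:M 0 0 U'.
have V1 : V *m V^T = 1%:M.
  rewrite /V tr_block_mx mulmx_block !trmx0 trmx1 !mulmx0 !mul0mx mul1mx U'1.
  by rewrite !addr0 add0r -scalar_mx_block.
have VM : V *m M = diag_mx (row_mx a%:M d') *m V.
  rewrite ME /V diag_mx_row !mulmx_block.
  rewrite !mulmx0 !mul0mx !addr0 !add0r mul1mx U'E mulmx1; congr block_mx.
  by apply/matrixP => i j; rewrite !mxE !ord1 eqxx.
exists (V *m Q), (row_mx a%:M d'); split.
  by rewrite trmx_mul mulmxA -(mulmxA V) QQ mulmx1 V1.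
have QTQ : Q^T *m Q = 1%:M by apply: mulmx1C.
have -> : V *m Q *m A = V *m M *m Q by rewrite MdE -!mulmxA QTQ mulmx1.
rewrite mulmxA; congr (_ *m Q).
exact: VM.
Qed.

End RealSpectral.

Lemma count_flatten_nseq (T : eqType) (x : T) (s : seq T) (m : T -> nat) :
  uniq s ->
  count_mem x (flatten [seq nseq (m y) y | y <- s]) = ((x \in s) * m x)%N.
Proof.
elim: s => //= y s IH /andP [ys us]; rewrite count_cat IH // count_nseq inE /=.
rewrite eq_sym; have [->|xy] := eqVneq x y; last by rewrite mul0n.
by rewrite (negPf ys) mul0n addn0 mul1n.
Qed.

Section Spectrum.
Variables (R : realType) (n : nat).
Implicit Type A : 'M[R]_n.

Lemma spectrum_prod (A : 'M[R]_n) (s : seq R) :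
  char_poly A = \prod_(y <- s) ('X - y%:P) -> perm_eq (spectrum A) s.
Proof.
move=> pE; rewrite /spectrum perm_sort; apply/allP => x _; apply/eqP.
have p0 : char_poly A != 0 by rewrite monic_neq0 // char_poly_monic.
rewrite count_flatten_nseq; last by apply/sorted_uniq/sorted_roots; [exact: lt_trans|exact: ltxx].
rewrite -roots_on_rootsR // inE /= -/(char_poly A).
have [rx|rx] := boolP (root (char_poly A) x).
  by rewrite mul1n pE mu_prod_XsubC.
by rewrite mul0n -(mu_prod_XsubC x s) -pE mupNroot.
Qed.

Lemma sym_spectrum (A : 'M[R]_n) : A^T = A ->
  size (spectrum A) = n /\
  exists U : 'M[R]_n, U *m U^T = 1%:M /\
    forall i, row i U *m A = (spectrum A)`_i *: row i U.
Proof.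
move=> symA; have [U [d [U1 UE]]] := sym_orthogonal_diag symA.
have UTU : U^T *m U = 1%:M by apply: mulmx1C.
have AE : char_poly A = \prod_(y <- [seq d 0 i | i <- enum 'I_n]) ('X - y%:P).
  have -> : char_poly A = char_poly (diag_mx d).
    have AE : A = U^T *m diag_mx d *m U by rewrite -mulmxA -UE mulmxA UTU mul1mx.
    rewrite /char_poly /char_poly_mx AE !map_mxM /=.
    pose f := @map_mx R {poly R} polyC n n.
    have fUTU : f U^T *m f U = 1%:M by rewrite /f -map_mxM UTU map_mx1.
    rewrite -!/(f _) -[X in X - _](mulmx1 ('X%:M)) -fUTU mulmxA -scalar_mxC.
    rewrite -mulmxBl -mulmxBr !det_mulmx mulrAC -det_mulmx fUTU det1.
    by rewrite mul1r.
  rewrite char_poly_trig ?diag_mx_is_trig // big_map big_enum /=.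
  by apply: eq_bigr => i _; rewrite mxE eqxx.
have := spectrum_prod AE; rewrite perm_sym => pE.
have sz : size (spectrum A) = n by rewrite -(perm_size pE) size_map size_enum_ord.
split=> //; pose t := [tuple d 0 i | i < n].
have /tuple_permP [p tE] : perm_eq (spectrum A) t by rewrite perm_sym.
exists (row_perm p U); split.
  apply/matrixP => i j.
  have /matrixP/(_ (p i) (p j)) := U1; rewrite !mxE (inj_eq perm_inj) => <-.
  by apply: eq_bigr => k _; rewrite !mxE.
move=> i; rewrite tE (nth_map i) ?size_enum_ord // nth_ord_enum tnth_mktuple.
have -> : row i (row_perm p U) = row (p i) U by apply/rowP => j; rewrite !mxE.
by rewrite -row_mul UE row_mul row_diag_mx -scalemxAl -rowE.
Qed.

End Spectrum.

(** * Quadratic forms of a graph *)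

Section Forms.
Variables (R : realFieldType) (V : finType).
Implicit Types (x y z : V -> R) (M : V -> V -> R) (e : rel V).

Definition dot x y := \sum_u x u * y u.
Definition lin a x b y := fun u => a * x u + b * y u.
Definition app M x := fun u => \sum_v M u v * x v.
Definition qform M x := dot x (app M x).

Definition adjk e : V -> V -> R := fun u v => (e u v)%:R.
Definition lapk e : V -> V -> R :=
  fun u v => (u == v)%:R * (degree e u)%:R - (e u v)%:R.

Lemma eq_dot x x' y y' : x =1 x' -> y =1 y' -> dot x y = dot x' y'.
Proof. by move=> ex ey; apply: eq_bigr => u _; rewrite ex ey. Qed.

Lemma dotC x y : dot x y = dot y x.
Proof. by apply: eq_bigr => u _; rewrite mulrC. Qed.

Lemma dot_linl a x b y z : dot (lin a x b y) z = a * dot x z + b * dot y z.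
Proof.
rewrite !mulr_sumr -big_split /=; apply: eq_bigr => u _.
by rewrite /lin mulrDl !mulrA.
Qed.

Lemma dot_linr a x b y z : dot z (lin a x b y) = a * dot z x + b * dot z y.
Proof. by rewrite dotC dot_linl !(dotC z). Qed.

Lemma app_lin M a x b y : app M (lin a x b y) =1 lin a (app M x) b (app M y).
Proof.
move=> u; rewrite /lin !mulr_sumr -big_split /=; apply: eq_bigr => v _.
by rewrite mulrDr !(mulrCA (M u v)).
Qed.

Lemma dot_ge0 x : 0 <= dot x x.
Proof. by apply: sumr_ge0 => u _; rewrite -expr2 sqr_ge0. Qed.

Lemma dot_eq0 x : dot x x = 0 -> forall u, x u = 0.
Proof.
move/eqP; rewrite psumr_eq0 => [/allP h u|u _]; last by rewrite -expr2 sqr_ge0.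
by have := h u; rewrite mem_index_enum mulf_eq0 orbb => /(_ isT) /eqP.
Qed.

Lemma dot_gt0 x u : x u != 0 -> 0 < dot x x.
Proof.
move=> xu; rewrite lt_neqAle dot_ge0 andbT eq_sym.
by apply: contra_neq xu => /dot_eq0.
Qed.

Lemma eq_app M x y : x =1 y -> app M x =1 app M y.
Proof. by move=> xy u; apply: eq_bigr => v _; rewrite xy. Qed.

Lemma eq_form M x y : x =1 y -> qform M x = qform M y.
Proof. by move=> xy; apply: eq_dot => // u; apply: eq_app. Qed.

Lemma dot_app M x y : (forall u v, M u v = M v u) ->
  dot x (app M y) = dot (app M x) y.
Proof.
move=> symM; rewrite /dot; under eq_bigr do rewrite mulr_sumr.
rewrite exchange_big /=; apply: eq_bigr => v _; rewrite mulr_suml.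
by apply: eq_bigr => u _; rewrite symM; ring.
Qed.

Lemma dot_lin a x b y : dot (lin a x b y) (lin a x b y) =
  a ^+ 2 * dot x x + 2 * a * b * dot x y + b ^+ 2 * dot y y.
Proof. by rewrite dot_linl !dot_linr (dotC y x); ring. Qed.

Lemma form_lin M a x b y : (forall u v, M u v = M v u) ->
  qform M (lin a x b y) =
  a ^+ 2 * qform M x + 2 * a * b * dot x (app M y) + b ^+ 2 * qform M y.
Proof.
move=> symM; rewrite /qform (eq_dot (fun u => erefl) (app_lin M a x b y)).
rewrite dot_linl !dot_linr (dotC y (app M x)) -(dot_app x y symM); ring.
Qed.

End Forms.

Lemma linear_form_kernel (R : realFieldType) (p q : R) :
  exists a b : R, 0 < a ^+ 2 + b ^+ 2 /\ a * p + b * q = 0.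
Proof.
have [p0|p0] := eqVneq p 0.
  exists 1, 0; rewrite p0; split; first by rewrite expr1n expr0n addr0 ltr01.
  by rewrite mulr0 mul0r addr0.
exists q, (- p); split; last by ring.
by rewrite ltr_wpDl ?sqr_ge0 // sqrrN exprn_even_gt0.
Qed.

Section EigenBasis.
Variables (R : realType) (V : finType) (M : V -> V -> R) (A : 'M[R]_#|V|).
Hypothesis symM : forall u v, M u v = M v u.
Hypothesis AE : forall i j, A i j = M (enum_val i) (enum_val j).

Local Notation d := (spectrum A).

Lemma sum_enum_val (F : V -> R) : \sum_u F u = \sum_(i < #|V|) F (enum_val i).
Proof. exact: (big_enum_val (A := V)). Qed.

Lemma spectrum_size : size d = #|V|.
Proof.
have symA : A^T = A by apply/matrixP => i j; rewrite mxE !AE symM.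
by have [] := sym_spectrum symA.
Qed.

Lemma eigenbasis : exists phi : 'I_#|V| -> V -> R,
  [/\ forall i, app M (phi i) =1 (fun u => d`_i * phi i u),
      forall i j, dot (phi i) (phi j) = (i == j)%:R
    & forall x y, dot x y = \sum_i dot x (phi i) * dot y (phi i)].
Proof.
have symA : A^T = A by apply/matrixP => i j; rewrite mxE !AE symM.
have [_ [U [U1 UE]]] := sym_spectrum symA.
exists (fun i u => U i (enum_rank u)); split=> [i u|i j|x y].
- have /rowP/(_ (enum_rank u)) := UE i; rewrite !mxE => <-.
  rewrite /app sum_enum_val; apply: eq_bigr => j _.
  by rewrite !mxE AE enum_rankK enum_valK symM mulrC.
- have /matrixP/(_ i j) := U1; rewrite !mxE => <-.
  rewrite /dot sum_enum_val; apply: eq_bigr => k _.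
  by rewrite !mxE enum_valK.
- have UTU : U^T *m U = 1%:M by apply: mulmx1C.
  have kron u v : \sum_i U i (enum_rank u) * U i (enum_rank v) = (u == v)%:R.
    have /matrixP/(_ (enum_rank u) (enum_rank v)) := UTU.
    rewrite !mxE (inj_eq enum_rank_inj) => <-.
    by apply: eq_bigr => i _; rewrite !mxE.
  transitivity (\sum_u \sum_v x u * y v * (u == v)%:R).
    apply: eq_bigr => u _; rewrite (bigD1 u) //= eqxx mulr1.
    by rewrite big1 ?addr0 // => v /negPf vu; rewrite eq_sym vu mulr0.
  under eq_bigr => u _ do under eq_bigr => v _ do rewrite -kron mulr_sumr.
  under eq_bigr => u _ do rewrite exchange_big /=.
  rewrite exchange_big /=; apply: eq_bigr => i _.
  rewrite /dot mulr_suml; apply: eq_bigr => u _; rewrite mulr_sumr.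
  by apply: eq_bigr => v _; ring.
Qed.

Lemma form_eigenbasis (phi : 'I_#|V| -> V -> R) x :
    (forall i, app M (phi i) =1 (fun u => d`_i * phi i u)) ->
    (forall x y, dot x y = \sum_i dot x (phi i) * dot y (phi i)) ->
  qform M x = \sum_(i < #|V|) d`_i * dot x (phi i) ^+ 2.
Proof.
move=> eigen parseval; rewrite /qform parseval; apply: eq_bigr => i _.
rewrite -(dot_app x (phi i) symM) (eq_dot (fun u => erefl) (eigen i)).
have -> : dot x (fun u => d`_i * phi i u) = d`_i * dot x (phi i).
  by rewrite /dot mulr_sumr; apply: eq_bigr => u _; rewrite mulrCA.
ring.
Qed.

Lemma spectrum_mono i j : (i <= j < #|V|)%N -> d`_i <= d`_j.
Proof.
move=> /andP [ij jn]; have s : sorted <=%R d by apply: sort_sorted; exact: le_total.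
apply: (sorted_leq_nth le_trans lexx 0 s) => //; rewrite inE spectrum_size //.
exact: leq_ltn_trans ij jn.
Qed.

Lemma second_eigenvalue_le : (1 < #|V|)%N ->
  exists w, forall x, dot x w = 0 -> d`_1 * dot x x <= qform M x.
Proof.
move=> V1; have [phi [eigen ortho parseval]] := eigenbasis.
pose i0 := Ordinal (ltnW V1); exists (phi i0) => x x0.
rewrite (form_eigenbasis x eigen parseval) parseval mulr_sumr.
apply: ler_sum => i _; rewrite -expr2.
have [->|ii0] := eqVneq i i0; first by rewrite x0 expr0n !mulr0.
rewrite ler_wpM2r ?sqr_ge0 // spectrum_mono // ltn_ord andbT lt0n.
by apply: contra ii0 => /eqP i0E; apply/eqP/val_inj.
Qed.

Lemma rev_spectrum1 : (1 < #|V|)%N -> (rev d)`_1 = d`_(#|V| - 2).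
Proof. by move=> V1; rewrite nth_rev spectrum_size. Qed.

Lemma second_eigenvalue_ge : (1 < #|V|)%N ->
  exists w, forall x, dot x w = 0 -> qform M x <= (rev d)`_1 * dot x x.
Proof.
move=> V1; have [phi [eigen ortho parseval]] := eigenbasis.
have lt1 : (#|V| - 1 < #|V|)%N by lia.
pose i0 := Ordinal lt1; exists (phi i0) => x x0.
rewrite (form_eigenbasis x eigen parseval) parseval mulr_sumr rev_spectrum1 //.
apply: ler_sum => i _; rewrite -expr2.
have [->|ii0] := eqVneq i i0; first by rewrite x0 expr0n !mulr0.
rewrite ler_wpM2r ?sqr_ge0 // spectrum_mono //; apply/andP; split; last by lia.
have : (i != #|V| - 1 :> nat)%N.
  by apply: contra ii0 => /eqP i0E; apply/eqP/val_inj.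
have := ltn_ord i; lia.
Qed.

Lemma second_eigenvalue_plane s : (1 < #|V|)%N ->
  exists x, [/\ exists u, x u != 0, x s = 0, (rev d)`_1 * dot x x <= qform M x
    & qform M x = (rev d)`_1 * dot x x -> app M x =1 (fun u => (rev d)`_1 * x u)].
Proof.
move=> V1; have [phi [eigen ortho parseval]] := eigenbasis.
have lt1 : (#|V| - 1 < #|V|)%N by lia.
have lt2 : (#|V| - 2 < #|V|)%N by lia.
pose i1 := Ordinal lt1; pose i2 := Ordinal lt2.
have i12 : (i1 == i2) = false.
  apply/negbTE/eqP => /(congr1 (@nat_of_ord _)) h.
  have {h} : (#|V| - 1 = #|V| - 2)%N := h; lia.
have [a [b [ab0 abs]]] := linear_form_kernel (phi i1 s) (phi i2 s).
have formphi i j : dot (phi i) (app M (phi j)) = d`_j * (i == j)%:R.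
  rewrite (eq_dot (fun u => erefl) (eigen j)) -ortho /dot mulr_sumr.
  by apply: eq_bigr => u _; rewrite mulrCA.
pose x := lin a (phi i1) b (phi i2).
have nx : dot x x = a ^+ 2 + b ^+ 2 by rewrite dot_lin !ortho i12 !eqxx /=; ring.
have fx : qform M x = d`_(#|V| - 1) * a ^+ 2 + d`_(#|V| - 2) * b ^+ 2.
  by rewrite form_lin // /qform !formphi i12 !eqxx /= -/(d`_i1) -/(d`_i2); ring.
have dle : d`_(#|V| - 2) <= d`_(#|V| - 1) by apply: spectrum_mono; rewrite leq_sub2l // lt1.
exists x; rewrite nx fx rev_spectrum1 //; split=> //.
- apply/existsP; apply: contraTT ab0 => /existsPn x0.
  rewrite -nx /dot big1 ?ltxx // => u _.
  by have := x0 u; rewrite negbK => /eqP ->; rewrite mul0r.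
- by have := sqr_ge0 a; nra.
- move=> eq u; rewrite app_lin /lin !eigen /x /lin /=.
  have : (d`_(#|V| - 1) - d`_(#|V| - 2)) * a ^+ 2 = 0 by lra.
  move/eqP; rewrite mulf_eq0 sqrf_eq0 subr_eq0 => /orP [/eqP ->|/eqP ->]; ring.
Qed.

Lemma form_le_spectral_radius x : qform M x <= spectral_radius A * dot x x.
Proof.
have [phi [eigen ortho parseval]] := eigenbasis.
rewrite (form_eigenbasis x eigen parseval) parseval mulr_sumr.
apply: ler_sum => i _; rewrite -expr2 ler_wpM2r ?sqr_ge0 //.
apply: le_trans (ler_norm _) _; rewrite /spectral_radius.
apply: (le_bigmax_seq 0 _ xpredT (fun a : R => `|a|)) => //.
by rewrite mem_nth // spectrum_size.
Qed.

Lemma spectral_radius_ge0 : 0 <= spectral_radius A.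
Proof. by rewrite /spectral_radius bigmax_ge_id. Qed.

Lemma spectral_radius_le l : (forall u v, 0 <= M u v) -> 0 <= l ->
  (forall x, qform M x <= l * dot x x) -> spectral_radius A <= l.
Proof.
move=> M0 l0 le_l; have [phi [eigen ortho parseval]] := eigenbasis.
rewrite /spectral_radius big_seq; apply: bigmax_le => // a /(nthP 0) [i0].
rewrite spectrum_size => lti <-; pose j := Ordinal lti.
pose y u := `|phi j u|.
have ny : dot y y = 1.
  have <- : dot (phi j) (phi j) = 1 by rewrite ortho eqxx.
  by apply: eq_bigr => u _; rewrite -normrM -expr2 ger0_norm ?sqr_ge0 // expr2.
have := le_l y; rewrite ny mulr1; apply: le_trans.
have -> : d`_i0 = qform M (phi j).
  rewrite (form_eigenbasis _ eigen parseval) (bigD1 j) //= ortho eqxx expr1n mulr1.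
  by rewrite big1 ?addr0 // => k /negPf kj; rewrite ortho eq_sym kj expr0n mulr0.
rewrite /qform /dot; apply: le_trans (ler_norm_sum _ _ _) _.
apply: ler_sum => u _; rewrite normrM ler_wpM2l //.
apply: le_trans (ler_norm_sum _ _ _) _; apply: ler_sum => v _.
by rewrite normrM ler_wpM2r // ger0_norm.
Qed.

End EigenBasis.

Section GraphForms.
Variables (R : realFieldType) (V : finType) (e : rel V).
Hypothesis syme : symmetric e.
Implicit Types x y z k : V -> R.

Lemma adjk_sym u v : adjk R e u v = adjk R e v u.
Proof. by rewrite /adjk syme. Qed.

Lemma lapk_sym u v : lapk R e u v = lapk R e v u.
Proof. by rewrite /lapk syme eq_sym; case: eqVneq => [->//|_]; rewrite !mul0r. Qed.

Lemma app_adjk x u : app (adjk R e) x u = \sum_(v | e u v) x v.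
Proof.
rewrite [RHS]big_mkcond; apply: eq_bigr => v _; rewrite /adjk.
by case: (e u v); rewrite (mul1r, mul0r).
Qed.

Lemma sumr_neighbors u (a : R) : \sum_(v | e u v) a = (degree e u)%:R * a.
Proof.
rewrite /degree -sum1_card natr_sum mulr_suml.
by apply: eq_big => [v|v _]; rewrite ?inE ?mul1r.
Qed.

Lemma app_lapk x u : app (lapk R e) x u = \sum_(v | e u v) (x u - x v).
Proof.
rewrite sumrB sumr_neighbors -(app_adjk x) /app /lapk.
under eq_bigr do rewrite mulrBl; rewrite sumrB; congr (_ - _).
rewrite (bigD1 u) //= eqxx mul1r big1 ?addr0 // => v /negPf vu.
by rewrite eq_sym vu !mul0r.
Qed.

Lemma form_lapk2 x :
  2 * qform (lapk R e) x = \sum_u \sum_(v | e u v) (x u - x v) ^+ 2.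
Proof.
pose f u v := if e u v then x u * (x u - x v) else 0.
have fE : qform (lapk R e) x = \sum_u \sum_v f u v.
  rewrite /qform /dot; apply: eq_bigr => u _; rewrite app_lapk mulr_sumr.
  by rewrite big_mkcond.
rewrite (_ : 2 = 1 + 1) // mulrDl mul1r {1}fE fE [X in _ + X]exchange_big -big_split /=.
apply: eq_bigr => u _; rewrite -big_split [RHS]big_mkcond /=; apply: eq_bigr => v _.
by rewrite /f (syme v u); case: (e u v); ring.
Qed.

Lemma form_lapk_ge0 x : 0 <= qform (lapk R e) x.
Proof.
have h : 0 <= 2 * qform (lapk R e) x.
  by rewrite form_lapk2; do 2!apply: sumr_ge0 => ? _; rewrite sqr_ge0.
by move: h; rewrite pmulr_rge0.
Qed.

Definition apart x y := forall u v, x u != 0 -> y v != 0 -> (u != v) && ~~ e u v.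

Lemma apart_dot x y : apart x y -> dot x y = 0.
Proof.
move=> xy; rewrite /dot big1 // => u _; apply/eqP; rewrite mulf_eq0.
by apply: contraT; rewrite negb_or => /andP [xu yu]; have := xy u u xu yu; rewrite eqxx.
Qed.

Lemma apart_adjk x y : apart x y -> dot x (app (adjk R e) y) = 0.
Proof.
move=> xy; rewrite /dot big1 // => u _; rewrite app_adjk mulr_sumr big1 // => v euv.
apply/eqP; rewrite mulf_eq0; apply: contraT; rewrite negb_or => /andP [xu yv].
by have := xy u v xu yv; rewrite euv andbF.
Qed.

Lemma apart_lapk x y : apart x y -> dot x (app (lapk R e) y) = 0.
Proof.
move=> xy; rewrite /dot big1 // => u _; rewrite app_lapk mulr_sumr big1 // => v euv.
apply/eqP; rewrite mulf_eq0; apply: contraT; rewrite negb_or => /andP [xu yv].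
have yu : y u = 0.
  by apply/eqP; apply: contraT => yu; have := xy u u xu yu; rewrite eqxx.
move: yv; rewrite yu sub0r oppr_eq0 => yv.
by have := xy u v xu yv; rewrite euv andbF.
Qed.

End GraphForms.

Section GraphSpectrum.
Variables (R : realType) (V : finType) (e : rel V).
Hypothesis syme : symmetric e.
Implicit Types x y z k : V -> R.

Lemma adjmxE i j : adjmx R e i j = adjk R e (enum_val i) (enum_val j).
Proof. by rewrite mxE. Qed.

Lemma lapmxE i j : lapmx R e i j = lapk R e (enum_val i) (enum_val j).
Proof.
rewrite !mxE /lapk (inj_eq enum_val_inj); congr (_ - _).
by case: eqVneq => [->|]; rewrite (mul1r, mul0r).
Qed.

Lemma lambda2_ge : (1 < #|V|)%N -> exists w : V -> R,
  forall x, dot x w = 0 -> qform (adjk R e) x <= lambda2 R e * dot x x.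
Proof. exact: (second_eigenvalue_ge (adjk_sym R syme) adjmxE). Qed.

Lemma lambda2_plane s : (1 < #|V|)%N -> exists x : V -> R,
  [/\ exists u, x u != 0, x s = 0, lambda2 R e * dot x x <= qform (adjk R e) x
    & qform (adjk R e) x = lambda2 R e * dot x x ->
      app (adjk R e) x =1 (fun u => lambda2 R e * x u)].
Proof. exact: (second_eigenvalue_plane (adjk_sym R syme) adjmxE). Qed.

Lemma mu2_le x : (1 < #|V|)%N -> \sum_u x u = 0 ->
  mu2 R e * dot x x <= qform (lapk R e) x.
Proof.
move=> V1 x0; rewrite leNgt; apply/negP => lt_x.
have [w hw] := second_eigenvalue_le (lapk_sym R syme) lapmxE V1.
have mu_gt0 : 0 < mu2 R e.
  rewrite ltNge; apply/negP => mu_le0.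
  have := form_lapk_ge0 syme x; have := dot_ge0 x; nra.
pose one := fun _ : V => 1 : R.
have one1 : 0 < dot one one.
  have /card_gt0P [u _] : (0 < #|V|)%N by lia.
  by apply: (dot_gt0 (u := u)); rewrite oner_eq0.
have app1 u : app (lapk R e) one u = 0.
  by rewrite app_lapk big1 // => v _; rewrite subrr.
have form1 : qform (lapk R e) one = 0.
  by rewrite /qform /dot big1 // => u _; rewrite app1 mulr0.
have dot1 : dot one x = 0 by rewrite -x0; apply: eq_bigr => u _; rewrite mul1r.
have dotl1 : dot one (app (lapk R e) x) = 0.
  rewrite (dot_app _ _ (lapk_sym R syme)) /dot big1 // => u _.
  by rewrite app1 mul0r.
have [a [b [ab0 abw]]] := linear_form_kernel (dot one w) (dot x w).
have := hw (lin a one b x); rewrite dot_linl abw => /(_ erefl).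
rewrite dot_lin (form_lin _ _ _ _ (lapk_sym R syme)) form1 dot1 dotl1.
rewrite -/(mu2 R e) => le_ab.
have [b0|b0] := eqVneq b 0.
  have a0 : 0 < a ^+ 2 by move: ab0; rewrite b0 expr0n addr0.
  have := mulr_gt0 mu_gt0 (mulr_gt0 a0 one1); move: le_ab; rewrite b0; lra.
have bpos : 0 < b ^+ 2 by rewrite exprn_even_gt0.
have h1 : 0 < b ^+ 2 * (mu2 R e * dot x x - qform (lapk R e) x).
  by rewrite mulr_gt0 // subr_gt0.
have h2 : 0 <= mu2 R e * (a ^+ 2 * dot one one).
  by apply: mulr_ge0; [exact: ltW | apply: mulr_ge0; [exact: sqr_ge0 | exact: ltW]].
lra.
Qed.

(* Some combination of k and z is orthogonal to the constants, with a nonzero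
   coefficient of z because k >= 0. *)
Lemma mu2_le_apart z k : (1 < #|V|)%N ->
  (forall u, 0 <= k u) -> (exists u, k u != 0) -> apart e z k ->
  qform (lapk R e) k <= mu2 R e * dot k k ->
  mu2 R e * dot z z <= qform (lapk R e) z.
Proof.
move=> V1 k0 [u ku] zk le_k; pose a := \sum_u k u; pose b := - \sum_u z u.
have apos : 0 < a ^+ 2.
  rewrite exprn_even_gt0 //= /a psumr_eq0 //; apply/allPn; exists u; rewrite ?mem_index_enum //.
have := mu2_le (x := lin a z b k) V1.
rewrite /lin big_split /= -!mulr_sumr -/a.
have -> : a * \sum_u z u + b * a = 0 by rewrite /b; ring.
move=> /(_ erefl); rewrite -/(lin a z b k) dot_lin form_lin; last exact: lapk_sym.
rewrite (apart_dot zk) (apart_lapk zk) !mulr0 !addr0 => h.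
have h1 : 0 <= b ^+ 2 * (mu2 R e * dot k k - qform (lapk R e) k).
  by rewrite mulr_ge0 ?sqr_ge0 // subr_ge0.
have h2 : 0 <= a ^+ 2 * (qform (lapk R e) z - mu2 R e * dot z z) by lra.
by move: h2; rewrite pmulr_rge0 // subr_ge0.
Qed.

Lemma lambda2_ge_apart r x y : (1 < #|V|)%N ->
  (exists u, x u != 0) -> (exists u, y u != 0) -> apart e x y ->
  r * dot x x <= qform (adjk R e) x -> r * dot y y <= qform (adjk R e) y ->
  r <= lambda2 R e.
Proof.
move=> V1 [u xu] [v yv] xy rx ry; have [w hw] := lambda2_ge V1.
have nx := dot_gt0 xu; have ny := dot_gt0 yv.
have [a [b [ab0 abw]]] := linear_form_kernel (dot x w) (dot y w).
have := hw (lin a x b y); rewrite dot_linl abw => /(_ erefl).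
rewrite dot_lin form_lin; last exact: adjk_sym.
rewrite (apart_dot xy) (apart_adjk xy) !mulr0 !addr0 => le_l.
set X := a ^+ 2 * dot x x + b ^+ 2 * dot y y in le_l.
have X0 : 0 < X.
  have [a0|a0] := eqVneq a 0.
    have : 0 < b ^+ 2 by move: ab0; rewrite a0 expr0n add0r.
    by rewrite /X a0 expr0n mul0r add0r => ?; rewrite mulr_gt0.
  apply: ltr_wpDr; first by apply: mulr_ge0; [exact: sqr_ge0 | exact: ltW].
  by apply: mulr_gt0; rewrite ?exprn_even_gt0.
rewrite -(ler_pM2r X0); apply: le_trans le_l; rewrite /X.
have := sqr_ge0 a; have := sqr_ge0 b; nra.
Qed.

Lemma fiedler_app f : fiedler e f ->
  app (lapk R e) (entry f) =1 (fun u => mu2 R e * entry f u).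
Proof.
move=> [_ fE] u; have /colP/(_ (enum_rank u)) := fE; rewrite !mxE => <-.
rewrite /app sum_enum_val; apply: eq_bigr => j _.
by rewrite lapmxE enum_rankK /entry enum_valK.
Qed.

Lemma induced_radiusP (X : {set V}) l : reflect
  (0 <= l /\ forall x, (forall u, u \notin X -> x u = 0) ->
     qform (adjk R e) x <= l * dot x x)
  (induced_radius R e X <= l).
Proof.
pose T := {x : V | x \in X}; pose e' : rel T := relpre val e.
have sym' : symmetric e' by move=> u v; rewrite /e' /= syme.
have AE i j : adjmx R e' i j = adjk R e' (enum_val i) (enum_val j) by rewrite mxE.
have sumE (F : V -> R) : (forall u, u \notin X -> F u = 0) ->
    \sum_u F u = \sum_(u : T) F (val u).
  move=> F0; rewrite -big_sub /= [RHS]big_mkcond; apply: eq_bigr => u _.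
  by case: ifPn => // /F0.
have dotE x y : (forall u, u \notin X -> x u = 0) ->
    dot x y = dot (x \o val : T -> R) (y \o val).
  by move=> x0; rewrite /dot sumE // => u /x0 ->; rewrite mul0r.
have formE x : (forall u, u \notin X -> x u = 0) ->
    qform (adjk R e) x = qform (adjk R e') (x \o val).
  move=> x0; rewrite /qform dotE //; apply: eq_dot => // u.
  by rewrite /= /app sumE // => v /x0 ->; rewrite mulr0.
apply: (iffP idP) => [le_l|[l0 le_l]].
  split=> [|x x0]; first exact: le_trans (spectral_radius_ge0 _) le_l.
  rewrite formE // dotE //; apply: le_trans (form_le_spectral_radius (adjk_sym R sym') AE _) _.
  by rewrite ler_wpM2r // dot_ge0.
apply: (spectral_radius_le (adjk_sym R sym') AE) => // x.
pose y u := if insub u is Some v then x v else 0.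
have yx : y \o val =1 x by move=> u; rewrite /= /y valK.
have y0 u : u \notin X -> y u = 0 by rewrite /y => /negPf uX; rewrite insubF.
have := le_l y y0; rewrite formE // dotE //.
by rewrite (eq_form _ yx) (eq_dot yx yx).
Qed.

End GraphSpectrum.

(** * Perron vectors *)

Definition connected_set (V : finType) (e : rel V) (X : {set V}) :=
  forall u v, u \in X -> v \in X -> connect (restr e X) u v.

Lemma connect_invariant (T : finType) (r : rel T) (P : pred T) u v :
  (forall a b, P a -> r a b -> P b) -> P u -> connect r u v -> P v.
Proof.
move=> rP Pu /connectP [p]; elim: p u Pu => [u Pu _ -> //|w p IH u Pu /= /andP [uw]].
by apply: IH; exact: rP uw.
Qed.

Section Perron.
Variables (R : realFieldType) (V : finType) (e : rel V) (D : V -> R).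
Hypothesis syme : symmetric e.
Implicit Types (x y : V -> R) (X : {set V}).

Definition schrodk : V -> V -> R := fun u v => (u == v)%:R * D u - (e u v)%:R.

Lemma schrodk_sym u v : schrodk u v = schrodk v u.
Proof. by rewrite /schrodk syme eq_sym; case: eqVneq => [->//|_]; rewrite !mul0r. Qed.

Lemma app_schrodk x u : app schrodk x u = D u * x u - \sum_(v | e u v) x v.
Proof.
rewrite -app_adjk /app /schrodk.
under eq_bigr do rewrite mulrBl; rewrite sumrB; congr (_ - _).
rewrite (bigD1 u) //= eqxx mul1r big1 ?addr0 // => v /negPf vu.
by rewrite eq_sym vu !mul0r.
Qed.

Lemma schrod_form_norm x : qform schrodk (fun u => `|x u|) <= qform schrodk x.
Proof.
apply: ler_sum => u _; rewrite !app_schrodk !mulrBr lerB //.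
  by rewrite mulrCA -normrM ger0_norm -?expr2 ?sqr_ge0 // expr2 mulrCA.
apply: le_trans (ler_norm _) _; rewrite normrM ler_wpM2l //.
exact: ler_norm_sum.
Qed.

Lemma schrod_grad0 X x u : (forall y, (forall u, u \notin X -> y u = 0) -> 0 <= qform schrodk y) ->
  (forall u, u \notin X -> x u = 0) -> qform schrodk x = 0 -> u \in X ->
  app schrodk x u = 0.
Proof.
move=> Q0 x0 Qx uX; pose d v : R := (v == u)%:R; set g := app schrodk x u.
have d0 v : v \notin X -> d v = 0.
  by move=> vX; rewrite /d; case: eqVneq => // vu; rewrite -vu (negPf vX) in uX.
have dg : dot x (app schrodk d) = g.
  rewrite (dot_app _ _ schrodk_sym) /dot (bigD1 u) //= /d eqxx mulr1.
  by rewrite big1 ?addr0 // => v /negPf ->; rewrite mulr0.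
have m0 := Q0 d d0; set m := qform schrodk d in m0.
have := Q0 (lin 1 x (- g / (m + 1)) d).
rewrite form_lin; last exact: schrodk_sym.
rewrite Qx dg -/m => /(_ _)-h.
have m1 : m + 1 != 0 by lra.
have {h} : 0 <= (- (g ^+ 2 * (m + 2))) / (m + 1) ^+ 2.
  rewrite (_ : _ / _ = 1 ^+ 2 * 0 + 2 * 1 * (- g / (m + 1)) * g + (- g / (m + 1)) ^+ 2 * m).
    by apply: h => v vX; rewrite /lin x0 // d0 // !mulr0 addr0.
  by field.
rewrite pmulr_lge0; last by rewrite invr_gt0 exprn_gt0 //; lra.
move=> h; have g0 := sqr_ge0 g; apply/eqP; rewrite -sqrf_eq0; apply/eqP.
nra.
Qed.

Lemma schrod_zero_spreads X y u v : connected_set e X ->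
  (forall u, u \in X -> 0 <= app schrodk y u) ->
  (forall u v, u \in X -> e u v -> 0 <= y v) ->
  u \in X -> y u = 0 -> v \in X -> y v = 0 /\ forall w, e v w -> y w = 0.
Proof.
move=> cX Ay y0 uX yu vX.
have step a b : a \in X -> y a = 0 -> e a b -> y b = 0.
  move=> aX ya ab; have := Ay a aX; rewrite app_schrodk ya mulr0 sub0r oppr_ge0.
  rewrite (bigD1 b) //= => h.
  have h0 : 0 <= \sum_(v | e a v && (v != b)) y v.
    by apply: sumr_ge0 => w /andP [aw _]; exact: y0 aX aw.
  by apply/eqP; rewrite eq_le (y0 a b) // andbT; lra.
have yv : y v = 0.
  have := connect_invariant (P := [pred w | (w \in X) && (y w == 0)]) _ _ (cX u v uX vX).
  move=> h; suff /andP [_ /eqP //] : (v \in X) && (y v == 0).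
  apply: h => [a b /andP [aX /eqP ya] /and3P [_ bX ab]|] /=; last by rewrite uX yu eqxx.
  by rewrite /= bX (step a b) ?eqxx.
by split=> // w; exact: step vX yv.
Qed.

Lemma schrod_kernel_sign X x : connected_set e X ->
  (forall y, (forall u, u \notin X -> y u = 0) -> 0 <= qform schrodk y) ->
  (forall u, u \notin X -> x u = 0) -> qform schrodk x = 0 ->
  [\/ forall u, x u = 0, forall u, u \in X -> 0 < x u
    | forall u, u \in X -> x u < 0].
Proof.
move=> cX Q0 x0 Qx; pose a u := `|x u|.
have a0 u : u \notin X -> a u = 0 by move=> uX; rewrite /a x0 // normr0.
have Qa : qform schrodk a = 0.
  by apply/eqP; rewrite eq_le Q0 // andbT -Qx schrod_form_norm.
have ga u : u \in X -> app schrodk a u = 0 by exact: schrod_grad0 Q0 a0 Qa.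
have gx u : u \in X -> app schrodk x u = 0 by exact: schrod_grad0 Q0 x0 Qx.
have [|no0] := boolP [exists u in X, x u == 0].
  move=> /exists_inP [u uX /eqP xu]; constructor 1 => v.
  have [vX|/x0 //] := boolP (v \in X).
  have [] := @schrod_zero_spreads X a u v cX _ _ uX _ vX.
  - by move=> w /ga ->.
  - by move=> *; rewrite normr_ge0.
  - by rewrite /a xu normr0.
  - by move=> /eqP; rewrite normr_eq0 => /eqP.
pose y := lin 1 a (-1) x.
have yE u : y u = `|x u| - x u by rewrite /y /lin mul1r mulN1r.
have y0 u : 0 <= y u by rewrite yE subr_ge0 ler_norm.
have gy u : u \in X -> 0 <= app schrodk y u.
  by move=> uX; rewrite app_lin /lin ga // gx // !mulr0 addr0.
have [|no0y] := boolP [exists u in X, y u == 0].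
  move=> /exists_inP [u uX /eqP yu]; constructor 2 => v vX.
  have [] := @schrod_zero_spreads X y u v cX gy _ uX yu vX; first by move=> *; exact: y0.
  rewrite yE => /eqP; rewrite subr_eq0 => /eqP xv _; rewrite lt_neqAle -xv normr_ge0 andbT.
  rewrite xv eq_sym; move: no0; rewrite negb_exists => /forallP /(_ v).
  by rewrite vX.
constructor 3 => u uX; rewrite ltNge; apply: contra no0y => xu.
by apply/exists_inP; exists u => //; rewrite yE ger0_norm ?subrr.
Qed.

End Perron.

Section CutVertex.
Variables (R : realType) (V : finType) (e : rel V).
Hypothesis syme : symmetric e.

Lemma schrod_form_adj (l : R) x :
  qform (schrodk e (fun _ => l)) x = l * dot x x - qform (adjk R e) x.
Proof.
rewrite /qform /dot mulr_sumr -sumrB; apply: eq_bigr => u _.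
by rewrite app_schrodk app_adjk mulrBr mulrCA.
Qed.

(* A lambda2-eigenvector vanishing at s would be a Perron vector of Y; its
   eigenequation at s then fails. *)
Lemma lambda2_cut_vertex (s y1 : V) (Y : {set V}) : (1 < #|V|)%N ->
  s \notin Y -> y1 \in Y -> e s y1 ->
  (forall u v, u \in Y -> v \notin Y -> e u v -> v = s) ->
  connected_set e Y ->
  (forall x, (forall u, u \notin Y -> x u = 0) ->
     qform (adjk R e) x <= lambda2 R e * dot x x) ->
  (forall x, (forall u, u \in Y -> x u = 0) -> x s = 0 ->
     lambda2 R e * dot x x <= qform (adjk R e) x -> forall u, x u = 0) ->
  False.
Proof.
move=> V1 sY y1Y sy1 cut cY leY posX; set l := lambda2 R e in leY posX.
have [x [[u xu] xs xl xeig]] := lambda2_plane R syme s V1; rewrite -/l in xl xeig.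
pose xY v := if v \in Y then x v else 0; pose xX v := if v \in Y then 0 else x v.
have xE : x =1 lin 1 xY 1 xX.
  by move=> v; rewrite /lin /xY /xX !mul1r; case: ifP; rewrite ?addr0 ?add0r.
have ap : apart e xY xX.
  move=> a b; rewrite /xY /xX; case: ifP; rewrite ?eqxx // => aY _.
  case: ifP => [_|/negbT bY xb]; rewrite ?eqxx //.
  have -> : a != b by apply: contraNneq bY => <-.
  apply/negP => ab; move: xb; rewrite (cut a b aY bY ab) xs eqxx //.
have dE : dot x x = dot xY xY + dot xX xX.
  by rewrite (eq_dot xE xE) dot_lin (apart_dot ap); ring.
have fE : qform (adjk R e) x = qform (adjk R e) xY + qform (adjk R e) xX.
  rewrite (eq_form _ xE) form_lin; last exact: adjk_sym.
  by rewrite (apart_adjk ap); ring.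
have hY := leY xY (fun v (vY : v \notin Y) => ifN _ _ vY).
have xX0 : forall v, xX v = 0.
  apply: posX => [v vY||]; rewrite /xX ?vY ?(negPf sY) //.
  by rewrite -/xX; move: xl; rewrite dE fE; lra.
have fX : qform (adjk R e) xX = 0 by rewrite /qform /dot big1 // => v _; rewrite xX0 mul0r.
have dX : dot xX xX = 0 by rewrite /dot big1 // => v _; rewrite xX0 mul0r.
have eqY : qform (adjk R e) xY = l * dot xY xY.
  by apply/eqP; rewrite eq_le hY /=; move: xl; rewrite dE fE fX dX !addr0.
have eqx : app (adjk R e) x s = 0.
  by rewrite xeig ?xs ?mulr0 // dE fE fX dX !addr0.
have xYE v : xY v = x v by rewrite xE /lin xX0 mul1r mulr0 addr0.
have kerY : qform (schrodk e (fun _ => l)) xY = 0 by rewrite schrod_form_adj eqY subrr.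
have pos y : (forall v, v \notin Y -> y v = 0) -> 0 <= qform (schrodk e (fun _ => l)) y.
  by move=> /leY; rewrite schrod_form_adj subr_ge0.
have xs0 v : e s v -> v \notin Y -> x v = 0.
  by move=> _ vY; rewrite -xYE /xY (negPf vY).
move: eqx; rewrite app_adjk (bigID (mem Y)) /= [X in _ + X]big1 ?addr0; last first.
  by move=> v /andP [sv vY]; exact: xs0.
have [] := schrod_kernel_sign syme cY pos _ kerY.
- by move=> v vY; rewrite /xY (negPf vY).
- by move=> h; move: xu; rewrite -xYE h eqxx.
- move=> h; rewrite (bigD1 y1) ?sy1 //= => eq0.
  have h1 : 0 < x y1 by rewrite -xYE h.
  have : 0 <= \sum_(v | e s v && (v \in Y) && (v != y1)) x v.
    by apply: sumr_ge0 => v /andP [/andP [_ vY] _]; rewrite -xYE ltW // h.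
  lra.
- move=> h; rewrite (bigD1 y1) ?sy1 //= => eq0.
  have h1 : x y1 < 0 by rewrite -xYE h.
  have : \sum_(v | e s v && (v \in Y) && (v != y1)) x v <= 0.
    by apply: sumr_le0 => v /andP [/andP [_ vY] _]; rewrite -xYE ltW // h.
  lra.
Qed.

End CutVertex.

(** * Paths minimize the spectral radius *)

Section RemovableVertex.
Variables (V : finType) (e : rel V).
Hypothesis syme : symmetric e.

Lemma restr_sym X : symmetric (restr e X).
Proof. by move=> u v; rewrite /restr /= syme andbCA. Qed.

Lemma connect_restr_sym X : connect_sym (restr e X).
Proof. exact: sym_connect_sym (restr_sym X). Qed.

Lemma connect_restrS (X Y : {set V}) u v :
  X \subset Y -> connect (restr e X) u v -> connect (restr e Y) u v.
Proof.
move=> sXY; apply: connect_sub => a b /and3P [aX bX ab].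
by apply: connect1; rewrite /restr /= (subsetP sXY a aX) (subsetP sXY b bX).
Qed.

Lemma connected_setU1 (X : {set V}) a t :
  connected_set e X -> a \in X -> e a t -> connected_set e (t |: X).
Proof.
move=> cX aX at_.
have to_a w : w \in t |: X -> connect (restr e (t |: X)) w a.
  case/setU1P => [->|wX]; last exact: connect_restrS (subsetUr _ _) (cX w a wX aX).
  by apply: connect1; rewrite /restr /= !inE eqxx aX orbT /= syme.
move=> u v /to_a ua /to_a va; apply: connect_trans ua _.
by rewrite connect_restr_sym.
Qed.

Lemma connected_set_exit (X Z : {set V}) u w :
  connected_set e X -> Z \subset X -> u \in Z -> w \in X -> w \notin Z ->
  exists a t, [/\ a \in Z, t \in X, t \notin Z & e a t].
Proof.
move=> cX sZX uZ wX wZ.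
have [/existsP [a /existsP [t /and4P [aZ tX tZ at_]]]|] :=
  boolP [exists a, exists t, [&& a \in Z, t \in X, t \notin Z & e a t]].
  by exists a, t.
move=> no; suff : w \in Z by rewrite (negPf wZ).
apply: (connect_invariant (P := fun v => v \in Z) _ uZ (cX u w (subsetP sZX u uZ) wX)).
move=> a b aZ /and3P [_ bX ab].
apply: contraNT no => bZ; apply/existsP; exists a; apply/existsP; exists b.
by rewrite aZ bX bZ.
Qed.

(* t is the complement of a maximal proper connected subset containing u. *)
Lemma removable_vertex (X : {set V}) u : connected_set e X -> u \in X -> (1 < #|X|)%N ->
  exists t a, [/\ t \in X, t != u, a \in X :\ t, e t a & connected_set e (X :\ t)].
Proof.
move=> cX uX X1.
pose P (Z : {set V}) := [&& u \in Z, Z \proper X &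
  [forall a in Z, forall b in Z, connect (restr e Z) a b]].
have P1 : P [set u].
  rewrite /P set11 properEcard sub1set uX cards1 X1 /=.
  by apply/forall_inP => a /set1P ->; apply/forall_inP => b /set1P ->; exact: connect0.
have [Z /maxsetP [/and3P [uZ pZ /forall_inP cZ] maxZ]] := ex_maxset (ex_intro P _ P1).
have {}cZ : connected_set e Z by move=> a b /cZ /forall_inP; apply.
have [w wX wZ] : exists2 w, w \in X & w \notin Z by case/properP: pZ.
have [a [t [aZ tX tZ at_]]] := connected_set_exit cX (proper_sub pZ) uZ wX wZ.
have cT := connected_setU1 cZ aZ at_.
have sT : t |: Z \subset X by rewrite subUset sub1set tX proper_sub.
have TX : t |: Z = X.
  apply/eqP; rewrite eqEsubset sT /=; apply: contraT => nsub.
  have PT : P (t |: Z).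
    rewrite /P !inE uZ orbT properE sT nsub /=.
    by apply/forall_inP => c cT'; apply/forall_inP => b bT; exact: cT.
  by have := maxZ _ PT (subsetUr _ _) => /setP /(_ t); rewrite setU11 (negPf tZ).
have XZ : X :\ t = Z by rewrite -TX setU1K.
exists t, a; rewrite XZ aZ syme at_ tX; split=> //.
by apply: contraNneq tZ => ->.
Qed.

End RemovableVertex.

Section Zigzag.
Variable R : realFieldType.
Implicit Types (s l p : seq R) (t a b c : R).

Definition second l : R := if l is b :: l' then head b l' else 0.

(* For l = [:: z_m; ...; z_1] nondecreasing this is
   z_1 z_2 + z_1 z_3 + z_2 z_4 + ... + z_(m-2) z_m, the edge sum of the path whose
   vertices carry the values in the order ..., z_5, z_3, z_1, z_2, z_4, ... *)
Fixpoint zigzag l : R := if l is t :: l' then zigzag l' + t * second l' else 0.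

Fixpoint path_sum a s : R := if s is b :: s' then a * b + path_sum b s' else 0.

Definition cycle_sum s : R := if s is a :: s' then path_sum a s' + last a s' * a else 0.

Lemma path_sum_cat a s1 b s2 :
  path_sum a (s1 ++ b :: s2) = path_sum a s1 + last a s1 * b + path_sum b s2.
Proof. by elim: s1 a => [|c s1 IH] a /=; rewrite ?add0r // IH !addrA. Qed.

Lemma cycle_sum_cat s1 s2 : cycle_sum (s1 ++ s2) = cycle_sum (s2 ++ s1).
Proof.
case: s1 s2 => [|a s1] [|b s2]; rewrite ?cats0 //=.
by rewrite !path_sum_cat !last_cat /=; ring.
Qed.

Lemma two_smallest t a m s b c l : sorted <=%R (t :: b :: c :: l) ->
  perm_eq (b :: c :: l) (a :: rcons s m) ->
  (b - t) * (c - t) <= (a - t) * (m - t).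
Proof.
rewrite /= => /and3P [tb bc pl] pe.
have ge_c x : x \in c :: l -> c <= x.
  rewrite inE => /predU1P [-> //|xl].
  by have := order_path_min le_trans pl => /allP /(_ x xl).
have mem_bl x : x \in a :: rcons s m -> b <= x.
  by rewrite -(perm_mem pe) inE => /predU1P [-> //|/ge_c]; exact: le_trans.
have ab : b <= a by rewrite mem_bl // mem_head.
have mb : b <= m by rewrite mem_bl // inE mem_rcons mem_head orbT.
have : (c <= a) || (c <= m).
  have : a \in b :: c :: l by rewrite (perm_mem pe) mem_head.
  rewrite inE => /predU1P [aE|/ge_c -> //]; apply/orP; right; apply: ge_c.
  move: pe; rewrite aE perm_cons => /perm_mem ->.
  by rewrite mem_rcons mem_head.
by case/orP => h; nra.
Qed.

Lemma cycle_sum_le_zigzag l s : sorted <=%R l -> perm_eq l s -> (1 < size l)%N ->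
  cycle_sum s <= zigzag l + l`_0 * l`_1.
Proof.
elim: l s => [|t [|b l] IH] // s sl pe _.
have ts : t \in s by rewrite -(perm_mem pe) mem_head.
have [s' pe' ->] : exists2 s', perm_eq (b :: l) s' & cycle_sum s = cycle_sum (t :: s').
  move: pe; case/splitPr: ts => s1 s2 pe; exists (s2 ++ s1).
    by move: pe; rewrite perm_sym perm_catC /= perm_cons perm_sym.
  by rewrite cycle_sum_cat.
case: l => [|c l] in sl pe pe' IH *.
  have -> : s' = [:: b] by apply: perm_small_eq => //; rewrite perm_sym.
  by rewrite /= !(mulr0, addr0, add0r) [b * t]mulrC.
case: s' pe' => [/perm_size //|a s'].
case: (lastP s') => [/perm_size //|s'' m] pe'.
have := IH _ (path_sorted sl) pe' isT; have := two_smallest sl pe'.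
by rewrite /= last_rcons; lra.
Qed.

Lemma path_sum_le_zigzag a s : all (>= 0) (a :: s) ->
  path_sum a s <= zigzag (sort <=%R (a :: s)).
Proof.
move=> /allP pos; set l := sort _ _.
have pl : perm_eq l (a :: s) by rewrite perm_sort.
have sl : sorted <=%R l by apply: sort_sorted; exact: le_total.
have s0 : sorted <=%R (0 :: l).
  rewrite /= path_min_sorted //; apply/allP => x.
  by rewrite (perm_mem pl); exact: pos.
have := cycle_sum_le_zigzag s0 (s := 0 :: a :: s).
rewrite perm_cons => /(_ pl); rewrite /= (perm_size pl) => /(_ isT).
by rewrite !(mul0r, mulr0, add0r, addr0).
Qed.

Variables (V : finType) (e : rel V).
Hypotheses (syme : symmetric e) (irre : irreflexive e).

(* Vertices are removed so that no vertex is adjacent to the one removed just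
   before; u is the vertex that must not be removed now. *)
Lemma zigzag_le_connected l (X : {set V}) u : sorted <=%R l -> all (>= 0) l ->
  connected_set e X -> u \in X -> #|X| = size l ->
  exists x : V -> R, [/\ forall v, v \notin X -> x v = 0,
    dot x x = \sum_(z <- l) z ^+ 2, 2 * zigzag l <= qform (adjk R e) x,
    forall v, v \in X -> l`_0 <= x v & second l <= x u].
Proof.
elim: l X u => [|t l IH] X u sl al cX uX cardX.
  by move: uX; rewrite (cards0_eq cardX) inE.
move: al; rewrite /= => /andP [t0 al].
have [l0|l0] := eqVneq l [::].
  have /eqP/cards1P [w Xw] : #|X| = 1%N by rewrite cardX l0.
  have uw : u = w by apply/set1P; rewrite -Xw.
  exists (fun v => if v == u then t else 0); rewrite l0 /= eqxx; split=> //.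
  - by move=> v; rewrite Xw inE uw => /negPf ->.
  - rewrite big_seq1 /dot (bigD1 u) //= eqxx big1 ?addr0 // => v /negPf ->.
    by rewrite mul0r.
  - rewrite !mulr0 addr0 mulr0; apply: sumr_ge0 => v _; apply: mulr_ge0.
      by case: ifP.
    by rewrite app_adjk; apply: sumr_ge0 => w' _; case: ifP.
  - by move=> v; rewrite Xw inE uw => ->.
have X1 : (1 < #|X|)%N by rewrite cardX /= ltnS lt0n size_eq0.
have [r [a [rX ru aX ra cXr]]] := removable_vertex syme cX uX X1.
have cardXr : #|X :\ r| = size l.
  by have := cardsD1 r X; rewrite rX cardX /= add1n => -[].
have [x [x0 nx qx lx xa]] := IH (X :\ r) a (path_sorted sl) al cXr aX cardXr.
have tl : t <= l`_0 by move: sl; rewrite /=; case: (l) l0 => //= ? ? _ /andP [].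
have xpos v : 0 <= x v.
  have [vX|/x0 -> //] := boolP (v \in X :\ r).
  exact: le_trans t0 (le_trans tl (lx v vX)).
have xr : x r = 0 by rewrite x0 // !inE eqxx.
pose d v : R := (v == r)%:R.
have dx : dot x d = 0.
  by rewrite /dot big1 // => v _; rewrite /d; case: eqVneq => [->|_]; rewrite ?xr (mul0r, mulr0).
have dd : dot d d = 1.
  rewrite /dot (bigD1 r) //= /d eqxx mulr1 big1 ?addr0 // => v /negPf ->.
  by rewrite mul0r.
have appd v : app (adjk R e) d v = (e v r)%:R.
  rewrite /app (bigD1 r) //= /d eqxx mulr1 big1 ?addr0 // => w /negPf ->.
  by rewrite mulr0.
have qd : qform (adjk R e) d = 0.
  rewrite /qform /dot (bigD1 r) //= appd irre mulr0 add0r big1 // => v /negPf vr.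
  by rewrite /d vr mul0r.
have qxd : second l <= dot x (app (adjk R e) d).
  rewrite (dot_app _ _ (adjk_sym R syme)) /dot (bigD1 r) //= /d eqxx mulr1.
  rewrite [X in _ + X]big1 ?addr0 => [|v /negPf ->]; last by rewrite mulr0.
  rewrite app_adjk (bigD1 a) //=; apply: le_trans xa _.
  by rewrite lerDl; apply: sumr_ge0 => *; exact: xpos.
have xdE v : lin 1 x t d v = if v == r then t else x v.
  by rewrite /lin /d mul1r; case: eqVneq => [->|_]; rewrite ?xr (mulr1, mulr0) (add0r, addr0).
exists (lin 1 x t d); split.
- move=> v vX; rewrite xdE; case: eqVneq => [vr|_]; first by rewrite vr rX in vX.
  by rewrite x0 // !inE (negPf vX) andbF.
- by rewrite big_cons dot_lin -nx dx dd; ring.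
- rewrite form_lin; last exact: adjk_sym.
  by rewrite qd /=; have := ler_wpM2l t0 qxd; lra.
- move=> v vX; rewrite xdE; case: eqVneq => [//|vr] /=.
  by apply: le_trans tl (lx v _); rewrite !inE vr.
- rewrite /= xdE eq_sym (negPf ru).
  have : l`_0 <= x u by rewrite lx // !inE uX eq_sym ru.
  by case: (l) l0.
Qed.

Lemma path_le_connected a s (X : {set V}) : all (>= 0) (a :: s) ->
  connected_set e X -> #|X| = size (a :: s) ->
  exists x : V -> R, [/\ forall v, v \notin X -> x v = 0,
    dot x x = \sum_(z <- a :: s) z ^+ 2 &
    2 * path_sum a s <= qform (adjk R e) x].
Proof.
move=> pos cX cardX; set l := sort <=%R (a :: s).
have pl : perm_eq l (a :: s) by rewrite perm_sort.
have /card_gt0P [u uX] : (0 < #|X|)%N by rewrite cardX.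
have [|||x [x0 nx qx _ _]] := @zigzag_le_connected l X u _ _ cX uX.
- by apply: sort_sorted; exact: le_total.
- by rewrite (eq_all_r (perm_mem pl)).
- by rewrite (perm_size pl).
exists x; rewrite nx (perm_big _ pl); split=> //.
apply: le_trans qx; rewrite ler_pM2l //.
exact: path_sum_le_zigzag.
Qed.

End Zigzag.

(** * Distances and rooted trees *)

Lemma bigminn_le_id (I : Type) (r : seq I) (P : pred I) F m :
  (\big[minn/m]_(i <- r | P i) F i <= m)%N.
Proof. by elim/big_rec: _ => // i n _; rewrite geq_min => ->; rewrite orbT. Qed.

Lemma bigminn_le (I : finType) (P : pred I) F m j :
  P j -> (\big[minn/m]_(i | P i) F i <= F j)%N.
Proof.
move=> Pj; have: j \in index_enum I by exact: mem_index_enum.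
elim: (index_enum I) => //= i r IH; rewrite inE big_cons => /predU1P [<-|/IH le_j].
  by rewrite Pj geq_minl.
by case: ifP => // _; rewrite geq_min le_j orbT.
Qed.

Section Distance.
Variables (V : finType) (e : rel V).
Implicit Types (x y u v : V) (p : seq V) (X Y : {set V}).

Lemma gdist_le x p : path e x p -> (gdist e x (last x p) <= size p)%N.
Proof.
move=> pp; rewrite /gdist; case: (ltnP (size p) #|V|) => pV; last first.
  by apply: leq_trans pV; exact: bigminn_le_id.
apply: (bigminn_le (fun n : 'I_#|V| => n : nat) _ (j := Ordinal pV)).
by apply/existsP; exists (in_tuple p); rewrite /= pp eqxx.
Qed.

Lemma gdist_path x y : connect e x y ->
  exists p, [/\ path e x p, last x p = y & size p = gdist e x y].
Proof.
move=> /connectP [p0 pp0 ->]; case/shortenP: pp0 => p pp up _.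
have [|//] : gdist e x (last x p) = #|V| \/ exists q,
    [/\ path e x q, last x q = last x p & size q = gdist e x (last x p)].
  rewrite /gdist; elim/big_ind: _ => [|a b Ka Kb|i /existsP [q /andP [pq /eqP lq]]].
  - by left.
  - by rewrite /minn; case: ifP.
  - by right; exists q; rewrite size_tuple.
move=> gV; have := gdist_le pp; rewrite gV leqNgt.
by have := max_card (mem (x :: p)); rewrite (card_uniqP up) => ->.
Qed.

Lemma gdist0 x : gdist e x x = 0%N.
Proof. by apply/eqP; rewrite -leqn0; exact: (@gdist_le x [::]). Qed.

Lemma gdist_eq0 x y : connect e x y -> gdist e x y = 0%N -> x = y.
Proof. by case/gdist_path => -[|? ?] [_ <- <-]. Qed.

Lemma gdist_edge x u v : connect e x u -> e u v -> (gdist e x v <= (gdist e x u).+1)%N.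
Proof.
case/gdist_path => p [pp lp <-] uv.
have := @gdist_le x (rcons p v); rewrite last_rcons size_rcons rcons_path pp lp.
exact.
Qed.

Lemma setdist_le X Y x y : x \in X -> y \in Y -> (setdist e X Y <= gdist e x y)%N.
Proof.
move=> xX yY; apply: leq_trans (bigminn_le _ _ xX) _; exact: bigminn_le.
Qed.

Lemma le_setdist X Y n : (n <= #|V|)%N ->
  (forall x y, x \in X -> y \in Y -> (n <= gdist e x y)%N) -> (n <= setdist e X Y)%N.
Proof.
move=> nV h; rewrite /setdist.
elim/big_ind: _ => // [a b|x xX]; first by rewrite leq_min => -> ->.
elim/big_ind: _ => // [a b|y yY]; first by rewrite leq_min => -> ->.
exact: h.
Qed.

Lemma le_gdist x y (f : V -> nat) n :
  (forall u v, e u v -> (f v <= (f u).+1)%N) -> (n <= #|V|)%N ->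
  (f x + n <= f y)%N -> (n <= gdist e x y)%N.
Proof.
move=> fe nV fxy; rewrite /gdist.
elim/big_ind: _ => // [a b|i /existsP [q /andP [pq /eqP lq]]].
  by rewrite leq_min => -> ->.
suff walk p : path e x p -> (f (last x p) <= f x + size p)%N.
  by have := walk _ pq; rewrite lq size_tuple; lia.
elim: p x {fxy i q pq lq} => [|w p IH] x /=; first by lia.
by move=> /andP [/fe xw /IH]; lia.
Qed.

Lemma path_restr X x p : path e x p -> all (fun w => w \in X) (x :: p) -> path (restr e X) x p.
Proof.
elim: p x => //= w p IH x /andP [xw pp] /and3P [xX wX aX].
by rewrite /restr /= xX wX xw IH //= wX aX.
Qed.

End Distance.

Definition rooted_tree (V : finType) (e : rel V) (r : V) (par : V -> V) (dep : V -> nat) :=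
  [/\ forall u v, e u v = ((u != r) && (v == par u)) || ((v != r) && (u == par v)),
      par r = r, dep r = 0%N & forall u, u != r -> dep u = (dep (par u)).+1].

Section TreeRooting.
Variables (V : finType) (e : rel V) (s : V).
Hypothesis hT : is_tree e.

Local Notation dep := (gdist e s).

Lemma tree_avoid u v : v != u -> (dep v <= dep u)%N -> connect (restr e (~: [set u])) s v.
Proof.
move=> vu le_vu; have [_ conn _] := hT.
have [p [pp lp sp]] := gdist_path (conn s v).
apply/connectP; exists p => //; apply: path_restr => //.
apply/allP => w /= wp; rewrite !inE; apply: contraL le_vu => /eqP wu.
rewrite -ltnNge; case/splitPl: wp pp lp sp => p1 p2 lp1; rewrite cat_path => /andP [pp1 _].
rewrite last_cat lp1 => lp2 <-; rewrite -wu -lp1.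
apply: leq_ltn_trans (gdist_le pp1) _; rewrite size_cat -addn1 leq_add2l.
by case: p2 lp2 => //= vE; rewrite -vE wu eqxx in vu.
Qed.

Lemma tree_parent_uniq u a b : e u a -> e u b ->
  (dep a <= dep u)%N -> (dep b <= dep u)%N -> a = b.
Proof.
have [[syme irre] conn acyc] := hT => ua ub da db.
have neq w : e u w -> w != u by move=> uw; apply: contraTneq uw => ->; rewrite irre.
have ca := tree_avoid (neq a ua) da; have cb := tree_avoid (neq b ub) db.
have : connect (restr e (~: [set u])) a b.
  by apply: connect_trans cb; rewrite connect_restr_sym.
case/connectP => p0 /shortenP [p pp up _] bE.
apply/eqP; apply: contraT => ab; exfalso.
have p0n : p != [::] by apply: contraNneq ab => p0E; rewrite bE p0E.
apply: (acyc (u :: a :: p)); first by case: (p) p0n.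
have pe : path e a p by apply: sub_path pp => x y /and3P [].
have pu : all (fun w => w != u) p.
  elim: p a {up bE p0n ua da ca ab pe} pp => //= w p IH x /andP [/and3P [_ wu _] /IH ->].
  by move: wu; rewrite !inE => ->.
apply/andP; split; first by rewrite /= rcons_path ua pe -bE syme ub.
rewrite cons_uniq up andbT inE eq_sym (negPf (neq a ua)) /=.
by apply/negP => /(allP pu); rewrite eqxx.
Qed.

Definition parent u : V := if u == s then s else odflt u [pick a | e u a && (dep a <= dep u)%N].

Lemma parentP u : u != s -> e u (parent u) /\ dep u = (dep (parent u)).+1.
Proof.
have [[syme irre] conn acyc] := hT => us.
have [p [pp lp sp]] := gdist_path (conn s u).
case: (lastP p) pp lp sp => [_ /eqP|q w]; first by rewrite eq_sym (negPf us).
rewrite rcons_path last_rcons size_rcons => /andP [pq qw] wE; rewrite {}wE in qw * => sq.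
have dq := gdist_le pq; have := gdist_edge (conn s _) qw => de.
rewrite /parent (negPf us); case: pickP => [a /andP [ua da]|/(_ (last s q))] /=.
  have -> : a = last s q.
    by apply: (tree_parent_uniq ua) => //; rewrite 1?syme //; lia.
  by rewrite syme; split=> //; lia.
by rewrite syme qw /=; lia.
Qed.

Lemma tree_rooted : rooted_tree e s parent dep.
Proof.
have [[syme irre] conn acyc] := hT.
have p_s : parent s = s by rewrite /parent eqxx.
split=> //; first last.
- by move=> u /parentP [].
- exact: gdist0.
have half u v : e u v -> (dep v <= dep u)%N -> (u != s) && (v == parent u).
  move=> uv dv.
  have us : u != s.
    apply: contraTneq uv => us; move: dv; rewrite us gdist0 leqn0 => /eqP dv.
    by rewrite -(gdist_eq0 (conn s v) dv) irre.
  have [up du] := parentP us; rewrite us /=; apply/eqP.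
  by apply: tree_parent_uniq uv up dv _; rewrite du.
move=> u v; apply/idP/idP => [uv|].
  have [/(half _ _ uv) -> //|/ltnW] := leqP (dep v) (dep u).
  by rewrite syme in uv => /(half _ _ uv) ->; rewrite orbT.
case/orP => /andP [us /eqP ->]; first by case: (parentP us).
by rewrite syme; case: (parentP us).
Qed.

End TreeRooting.

Section RootedTree.
Variables (V : finType) (e : rel V) (r : V) (par : V -> V) (dep : V -> nat).
Hypothesis rt : rooted_tree e r par dep.

Lemma rooted_edge u v : e u v = ((u != r) && (v == par u)) || ((v != r) && (u == par v)).
Proof. by have [] := rt. Qed.

Lemma rooted_dep u : u != r -> dep u = (dep (par u)).+1.
Proof. by have [_ _ _] := rt; apply. Qed.

Lemma rooted_dep0 u : dep u = 0%N -> u = r.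
Proof. by move=> du; apply/eqP; apply: contraT => /rooted_dep; rewrite du. Qed.

Lemma rooted_parent u : u != r -> e u (par u).
Proof. by move=> ur; rewrite rooted_edge ur eqxx. Qed.

Lemma rooted_sym : symmetric e.
Proof. by move=> u v; rewrite !rooted_edge orbC. Qed.

Lemma rooted_irr : irreflexive e.
Proof.
move=> u; rewrite rooted_edge orbb; apply/negP => /andP [/rooted_dep du /eqP uE].
by move: du; rewrite -uE => /eqP; rewrite -[X in X == _]addn0 -addn1 eqn_add2l.
Qed.

Lemma rooted_asym u v : u != r -> v == par u -> (v != r) && (u == par v) = false.
Proof.
move=> /rooted_dep du /eqP vE; apply/negP => /andP [/rooted_dep dv /eqP uE].
by move: du; rewrite -vE dv -uE; lia.
Qed.

(* [fconnect par u a] says that a is u or one of its ancestors. *)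
Lemma ancestorE u a :
  fconnect par u a = (u == a) || fconnect par (par u) a.
Proof.
have [->|ua] /= := eqVneq u a; first exact: connect0.
apply/idP/idP => [|h]; last by apply: connect_trans h; exact: fconnect1.
case/connectP => -[/= _ /esym/eqP|w q /= /andP [/eqP <- pq] ->].
  by rewrite (negPf ua).
by apply/connectP; exists q.
Qed.

Lemma ancestor_root a : fconnect par r a -> a = r.
Proof.
move=> ra; apply/eqP; apply: (connect_invariant (P := fun v => v == r) _ _ ra) => //.
by move=> x y /eqP -> /eqP <-; have [_ -> _ _] := rt.
Qed.

Lemma ancestor_dep u a : fconnect par u a -> (dep a <= dep u)%N.
Proof.
move=> ua; apply: (connect_invariant (P := fun v => (dep v <= dep u)%N) _ _ ua) => //.
move=> x y dx /eqP <-; have [->|xr] := eqVneq x r; first by have [_ -> -> _] := rt.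
by move: dx; rewrite (rooted_dep xr); lia.
Qed.

Lemma ancestor_neq u a : u != r -> fconnect par (par u) a -> u != a.
Proof.
move=> ur /ancestor_dep; apply: contraTneq => <-.
by rewrite (rooted_dep ur) -ltnNge.
Qed.

Lemma rooted_connected_set (X : {set V}) :
  (forall u, u \in X -> par u \in X) -> connected_set e X.
Proof.
move=> parX; have to_root u : u \in X -> connect (restr e X) u r.
  move dE: (dep u) => n; elim: n u dE => [u /rooted_dep0 -> _|n IH u du uX].
    exact: connect0.
  have [->|ur] := eqVneq u r; first exact: connect0.
  apply: connect_trans (IH _ _ (parX _ uX)).
    by apply: connect1; rewrite /restr /= uX parX // rooted_parent.
  by move: du; rewrite (rooted_dep ur) => -[].
move=> u v /to_root ur /to_root vr; apply: connect_trans ur _.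
by rewrite (connect_restr_sym rooted_sym).
Qed.

Lemma sum_ancestors (T : nmodType) (F : nat -> T) c :
  \sum_(u | (u != r) && fconnect par c u) F (dep u) = \sum_(i < dep c) F i.+1.
Proof.
move dE: (dep c) => n; elim: n c dE => [c /rooted_dep0 ->|n IH c dc].
  by rewrite big_ord0 big_pred0 // => u; apply/negP => /andP [ur /ancestor_root /eqP]; exact/negP.
have cr : c != r by apply: contra_eq_neq dc => ->; have [_ _ -> _] := rt.
rewrite big_ord_recr /= -(IH (par c)); last by move: dc; rewrite (rooted_dep cr) => -[].
rewrite (bigD1 c) /=; last by rewrite cr connect0.
rewrite addrC dc; congr (_ + _); apply: eq_bigl => u.
rewrite ancestorE (eq_sym c u); case: (eqVneq u c) => [->|uc] /=; last by rewrite andbT.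
by rewrite andbF; apply/esym/negP => /andP [_ /(ancestor_neq cr)]; rewrite eqxx.
Qed.

Lemma sum_edges (T : nmodType) (f : V -> V -> T) :
  \sum_u \sum_(v | e u v) f u v = \sum_(u | u != r) (f u (par u) + f (par u) u).
Proof.
have -> : \sum_u \sum_(v | e u v) f u v =
    \sum_u \sum_(v | (u != r) && (v == par u)) f u v +
    \sum_u \sum_(v | (v != r) && (u == par v)) f u v.
  rewrite -big_split /=; apply: eq_bigr => u _.
  rewrite (bigID (fun v => (u != r) && (v == par u))) /=; congr (_ + _); apply: eq_bigl => v.
    by rewrite rooted_edge; case: ((u != r) && _); rewrite ?andbF.
  rewrite rooted_edge; have [/andP [ur vE]|] := boolP ((u != r) && (v == par u)).
    by rewrite rooted_asym.
  by rewrite andbT.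
rewrite [X in _ + X](exchange_big_dep xpredT) //= big_split /=; congr (_ + _).
  rewrite [RHS]big_mkcond; apply: eq_bigr => u _.
  by case: ifP => ur /=; rewrite ?big_pred1_eq // big_pred0.
rewrite [RHS]big_mkcond /=; apply: eq_bigr => u _.
by case: ifP => ur; rewrite ?big_pred1_eq // big_pred0.
Qed.

Variable R : realFieldType.
Implicit Type x : V -> R.

Lemma rooted_adj_form x : qform (adjk R e) x = 2 * \sum_(u | u != r) x u * x (par u).
Proof.
rewrite /qform /dot; under eq_bigr do rewrite app_adjk mulr_sumr.
rewrite sum_edges mulr_sumr; apply: eq_bigr => u _; ring.
Qed.

Lemma rooted_lap_form x :
  qform (lapk R e) x = \sum_(u | u != r) (x u - x (par u)) ^+ 2.
Proof.
apply: (mulfI (x := 2)); first by rewrite pnatr_eq0.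
rewrite (form_lapk2 rooted_sym x) sum_edges mulr_sumr.
by apply: eq_bigr => u _; ring.
Qed.

Lemma rooted_lap_dot x y : dot x (app (lapk R e) y) =
  \sum_(u | u != r) (x u - x (par u)) * (y u - y (par u)).
Proof.
rewrite /dot; under eq_bigr do rewrite app_lapk mulr_sumr.
rewrite sum_edges; apply: eq_bigr => u _; ring.
Qed.

End RootedTree.

(** * Branches and descendants *)

Section Branch.
Variables (V : finType) (e : rel V) (s : V) (par : V -> V) (dep : V -> nat).
Hypothesis rt : rooted_tree e s par dep.
Variables (c : V).
Hypothesis cs : c != s.

Local Notation anc := (fconnect par).
Local Notation B := (branch e s c).

Lemma branch_top : exists v1, [/\ anc c v1, v1 != s & par v1 = s].
Proof.
move dE: (dep c) => n; elim: n c cs dE => [c' c's /(rooted_dep0 rt) c'E|n IH c' c's dc].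
  by rewrite c'E eqxx in c's.
have [ps|ps] := eqVneq (par c') s; first by exists c'; rewrite connect0.
have [|v1 [cv v1s pv]] := IH _ ps; first by move: dc; rewrite (rooted_dep rt c's) => -[].
by exists v1; split=> //; apply: connect_trans cv; exact: fconnect1.
Qed.

Lemma ancestor_avoids_root u v : anc u v -> v != s -> u != s.
Proof. by move=> uv; apply: contraNneq => us; move: uv; rewrite us => /(ancestor_root rt) ->. Qed.

Lemma connect_ancestor u v : anc u v -> v != s -> connect (restr e (~: [set s])) u v.
Proof.
move dE: (dep u) => n; elim: n u dE => [u /(rooted_dep0 rt) -> /(ancestor_root rt) -> /eqP //|n IH u du uv vs].
have us := ancestor_avoids_root uv vs.
move: uv; rewrite ancestorE => /orP [/eqP ->|puv]; first exact: connect0.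
have ps := ancestor_avoids_root puv vs.
apply: connect_trans (IH _ _ puv vs); last by move: du; rewrite (rooted_dep rt us) => -[].
by apply: connect1; rewrite /restr /= !inE us ps (rooted_parent rt).
Qed.

Lemma branchE v1 : anc c v1 -> v1 != s -> par v1 = s -> forall u, (u \in B) = anc u v1.
Proof.
move=> cv v1s pv u; rewrite inE; apply/idP/idP => [cu|uv].
  apply: (connect_invariant (P := fun w => anc w v1) _ cv cu) => a b av /and3P [].
  rewrite !inE => as_ bs; rewrite (rooted_edge rt) => /orP [] /andP [_ /eqP ab].
    move: av; rewrite ancestorE -ab => /orP [/eqP a1|//].
    by move: bs; rewrite ab a1 pv eqxx.
  by rewrite ancestorE -ab av orbT.
apply: connect_trans (connect_ancestor cv v1s) _.
rewrite (connect_restr_sym (rooted_sym rt)); exact: connect_ancestor.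
Qed.

Lemma branch_neq_root u : u \in B -> u != s.
Proof.
have [v1 [cv v1s pv]] := branch_top; rewrite (branchE cv v1s pv) => uv.
exact: ancestor_avoids_root uv v1s.
Qed.

Lemma root_notin_branch : s \notin B.
Proof. by apply/negP => /branch_neq_root; rewrite eqxx. Qed.

Lemma parent_notin_branch u : u \notin B -> par u \notin B.
Proof.
have [v1 [cv v1s pv]] := branch_top; rewrite !(branchE cv v1s pv).
have [->|us] := eqVneq u s; first by have [_ -> _ _] := rt.
by rewrite ancestorE negb_or => /andP [].
Qed.

Lemma parent_in_branch u : u \in B -> ~~ anc c u -> par u \in B.
Proof.
have [v1 [cv v1s pv]] := branch_top; rewrite !(branchE cv v1s pv).
by rewrite ancestorE => /orP [/eqP ->|//]; rewrite cv.
Qed.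

Lemma ancestor_in_branch u : anc c u -> u != s -> u \in B.
Proof. by move=> cu us; rewrite inE; exact: connect_ancestor. Qed.

Lemma descendant_in_branch u : anc u c -> u \in B.
Proof.
have [v1 [cv v1s pv]] := branch_top; rewrite (branchE cv v1s pv) => uc.
exact: connect_trans uc cv.
Qed.

Lemma branch_exit u v : u \in B -> v \notin B -> e u v -> v = s.
Proof.
move=> uB vB.
rewrite (rooted_edge rt) => /orP [/andP [_ /eqP vE]|/andP [vs /eqP uE]]; last first.
  by move: (parent_notin_branch vB); rewrite -uE uB.
have [v1 [cv v1s pv]] := branch_top.
move: uB vB; rewrite !(branchE cv v1s pv) ancestorE vE.
by case/orP => [/eqP ->|->].
Qed.

Lemma branch_connected : connected_set e B.
Proof.
have [v1 [cv v1s pv]] := branch_top.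
have to1 u : u \in B -> connect (restr e B) u v1.
  move dE: (dep u) => n; elim: n u dE => [u /(rooted_dep0 rt) -> |n IH u du uB].
    by rewrite (negPf root_notin_branch).
  have us := branch_neq_root uB.
  have := uB; rewrite (branchE cv v1s pv) ancestorE => /orP [/eqP ->|puv].
    exact: connect0.
  have pB : par u \in B by rewrite (branchE cv v1s pv).
  apply: connect_trans (IH _ _ pB); last by move: du; rewrite (rooted_dep rt us) => -[].
  by apply: connect1; rewrite /restr /= uB pB (rooted_parent rt).
move=> u v /to1 u1 /to1 v1'; apply: connect_trans u1 _.
by rewrite (connect_restr_sym (rooted_sym rt)).
Qed.

Definition strict_descendants : {set V} := [set u | anc u c && (u != c)].

Lemma card_strict_descendants : (#|strict_descendants| + dep c <= #|B|)%N.
Proof.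
have cardA : #|[set u | (u != s) && anc c u]| = dep c.
  have dE : (\sum_(i < dep c) 1 = dep c)%N by rewrite big_const_ord iter_addn_0 mul1n.
  rewrite -sum1_card -[RHS]dE; apply: etrans (sum_ancestors rt (fun _ => 1%N) c).
  by apply: eq_bigl => u; rewrite inE.
rewrite -cardA -cardsUI [X in (_ + X)%N](_ : _ = 0%N) ?addn0.
  apply: subset_leq_card; apply/subsetP => u /setUP [].
    by rewrite in_set => /andP [/descendant_in_branch].
  by rewrite in_set => /andP [us cu]; exact: ancestor_in_branch.
apply/eqP; rewrite cards_eq0 -subset0; apply/subsetP => u.
rewrite !inE => /andP [/andP [uc uNc] /andP [us cu]].
have us' := ancestor_avoids_root uc cs.
move: uc; rewrite ancestorE (negPf uNc) /= => /(ancestor_dep rt).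
by have := ancestor_dep rt cu; rewrite (rooted_dep rt us'); lia.
Qed.

(* The index, on the path s = v_0, ..., v_d = c, of the vertex closest to u. *)
Definition projection u : nat := \sum_(a | (a != s) && anc c a) anc u a.

Lemma projection_root : projection s = 0%N.
Proof.
rewrite /projection big1 // => a /andP [as_ _].
by case: (boolP (anc s a)) => // /(ancestor_root rt) /eqP; rewrite (negPf as_).
Qed.

Lemma projection_parent u : u != s -> projection u = (projection (par u) + anc c u)%N.
Proof.
move=> us; rewrite /projection.
have aE a : anc u a = (anc (par u) a + (u == a))%N :> nat.
  rewrite ancestorE; have [<-|ua] := eqVneq u a; last by rewrite addn0.
  by case: (boolP (anc (par u) u)) => // /(ancestor_neq rt us); rewrite eqxx.
under eq_bigr do rewrite aE; rewrite big_split /=; congr addn.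
have [cu|cu] := boolP (anc c u).
  rewrite (bigD1 u) ?us ?cu //= eqxx big1 ?addn0 // => a /andP [_ /negPf].
  by rewrite eq_sym => ->.
rewrite big1 // => a /andP [_ ca]; case: eqVneq => // ua.
by rewrite ua ca in cu.
Qed.

Lemma projection_ancestor u : anc c u -> projection u = dep u.
Proof.
move dE: (dep u) => n; elim: n u dE => [u /(rooted_dep0 rt) -> _|n IH u du cu].
  exact: projection_root.
have us : u != s by apply: contra_eq_neq du => ->; have [_ _ -> _] := rt.
rewrite projection_parent // cu IH ?addn1 //; first by move: du; rewrite (rooted_dep rt us) => -[].
by apply: connect_trans cu _; exact: fconnect1.
Qed.

Lemma projection_descendant u : anc u c -> projection u = dep c.
Proof.
move=> uc; rewrite -(projection_ancestor (connect0 _ c)).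
by apply: eq_bigr => a /andP [_ ca]; rewrite ca (connect_trans uc ca).
Qed.

Variable R : realFieldType.

Lemma unproject (x : V -> R) (p : nat -> R) :
  p 0%N = x s -> (forall i, (dep c <= i)%N -> p i = 0) ->
  exists z : V -> R, [/\ forall u, anc u c -> z u = 0,
    qform (lapk R e) z = \sum_(u | (u \notin B) && (u != s)) (x u - x (par u)) ^+ 2 +
      \sum_(i < dep c) (p i.+1 - p i) ^+ 2 &
    \sum_(u | u \notin B) x u ^+ 2 + \sum_(i < dep c) p i.+1 ^+ 2 <= dot z z].
Proof.
move=> p0 pc; pose z u := if u \in B then p (projection u) else x u.
exists z; split.
- by move=> u uc; rewrite /z descendant_in_branch // projection_descendant // pc.
- rewrite (rooted_lap_form rt) (bigID (mem B)) /= addrC; congr (_ + _).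
    apply: eq_big => [u|u /andP [us uB]]; first by rewrite andbC.
    by rewrite /z (negPf uB) (negPf (parent_notin_branch uB)).
  rewrite -(sum_ancestors rt (fun i => (p i - p i.-1) ^+ 2)).
  rewrite (bigID (anc c)) /= addrC big1 ?add0r.
    apply: eq_big => [u|u /andP [/andP [us uB] cu]].
      by case: (boolP (anc c u)) => cu; rewrite ?andbF // !andbT;
         case: eqVneq => //= us; rewrite ancestor_in_branch.
    rewrite /z uB projection_ancestor //; congr (_ ^+ 2); congr (_ - _).
    have [pB|pB] := boolP (par u \in B).
      rewrite projection_ancestor ?(rooted_dep rt us) //.
      by apply: connect_trans cu _; exact: fconnect1.
    have -> : par u = s.
      by apply: branch_exit uB pB _; exact: (rooted_parent rt us).
    rewrite -p0; congr p; rewrite (rooted_dep rt us) /=.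
    have -> : par u = s by apply: branch_exit uB pB _; exact: (rooted_parent rt us).
    by have [_ _ -> _] := rt.
  move=> u /andP [/andP [us uB] cu].
  by rewrite /z uB parent_in_branch // projection_parent // (negPf cu) addn0 subrr expr0n.
- rewrite /dot [leRHS](bigID (mem B)) /= [leLHS]addrC; apply: lerD; last first.
    rewrite le_eqVlt; apply/orP; left; apply/eqP; apply: eq_bigr => u uB.
    by rewrite /z (negPf uB) expr2.
  rewrite -(sum_ancestors rt (fun i => p i ^+ 2)) [leRHS](bigID (anc c)) /=.
  rewrite -[leLHS]addr0; apply: lerD.
    rewrite le_eqVlt; apply/orP; left; apply/eqP; apply: eq_big => [u|u /andP [us cu]].
      case: (boolP (anc c u)) => cu; rewrite ?andbF // !andbT.
      by apply/idP/idP => [/(ancestor_in_branch cu) //|/branch_neq_root].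
    by rewrite /z ancestor_in_branch // projection_ancestor // expr2.
  by apply: sumr_ge0 => u _; rewrite -expr2 sqr_ge0.
Qed.

End Branch.

Section Descendants.
Variables (V : finType) (e : rel V) (r : V) (par : V -> V) (dep : V -> nat).
Hypothesis rt : rooted_tree e r par dep.
Variables (R : realFieldType) (c : V).

Local Notation anc := (fconnect par).
Local Notation X := (strict_descendants par c).

Lemma strict_descendant_parent u : u != r ->
  (u \in X) = (par u == c) || (par u \in X).
Proof.
move=> ur; rewrite !inE ancestorE.
have [uc|uc] /= := eqVneq u c; last first.
  by rewrite andbT; case: eqVneq => [->|_] //=; rewrite ?connect0 ?andbT.
subst u; apply/esym/negP.
have [/(ancestor_neq rt ur)|pc] := boolP (anc (par c) c); first by rewrite eqxx.
by rewrite andFb orbF => /eqP pc'; move: pc; rewrite pc' connect0.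
Qed.

(* On every edge the negative part k of g satisfies
   (k_u - k_v) (g_u - g_v) <= - (k_u - k_v)^2. *)
Lemma negative_part_descendants (g : V -> R) mu w :
  app (lapk R e) g =1 (fun u => mu * g u) -> 0 <= g c ->
  w != r -> par w = c -> g w < 0 ->
  exists k : V -> R, [/\ forall u, 0 <= k u, k w != 0, forall u, k u != 0 -> u \in X
    & qform (lapk R e) k <= mu * dot k k].
Proof.
move=> eig gc wr wc gw; pose k u := if u \in X then Num.max 0 (- g u) else 0.
have k0 u : 0 <= k u by rewrite /k; case: ifP => // _; rewrite le_max lexx.
exists k; split=> //.
- rewrite /k strict_descendant_parent // wc eqxx /=.
  by rewrite gt_eqF // lt_max oppr_gt0 gw orbT.
- by move=> u; rewrite /k; case: ifP; rewrite ?eqxx.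
have kg : dot k (app (lapk R e) g) = - (mu * dot k k).
  rewrite (eq_dot (fun u => erefl) eig) /dot mulr_sumr -sumrN.
  apply: eq_bigr => u _; rewrite /k; case: ifP => _; rewrite ?mul0r ?mulr0 ?oppr0 //.
  by rewrite /Num.max; case: ltP => _; rewrite ?mul0r ?mulr0 ?oppr0 //; ring.
suff : dot k (app (lapk R e) g) <= - qform (lapk R e) k by rewrite kg lerN2.
rewrite (rooted_lap_dot rt) (rooted_lap_form rt) -sumrN; apply: ler_sum => u ur.
rewrite /k strict_descendant_parent //.
have [pc|pc] /= := eqVneq (par u) c.
  rewrite pc; have -> : (c \in X) = false by rewrite inE eqxx andbF.
  by rewrite /Num.max; case: ltP; nra.
case: ifP => _; last by rewrite subrr mul0r expr0n oppr0.
rewrite /Num.max; case: ltP => hu; case: ltP => hp.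
- lra.
- have : 0 <= - g u * g (par u) by apply: mulr_ge0; lra.
  lra.
- have : 0 <= g u * - g (par u) by apply: mulr_ge0; lra.
  lra.
- lra.
Qed.

(* The running maximum of k along an enumeration of X by depth: the parent of each
   vertex comes earlier, so no increment exceeds the one along the parent edge. *)
Lemma path_rearrangement (k : V -> R) : (forall u, 0 <= k u) ->
  (forall u, k u != 0 -> u \in X) ->
  exists q : nat -> R, [/\ q 0%N = 0, forall i, 0 <= q i &
    forall N, (#|X| <= N)%N ->
      \sum_(i < N) (q i.+1 - q i) ^+ 2 <= qform (lapk R e) k /\
      dot k k <= \sum_(i < N) q i.+1 ^+ 2].
Proof.
move=> k0 kX; pose le_dep u v := (dep u <= dep v)%N.
pose l := sort le_dep (enum X).
have [q [q00 qS q_past]] : exists q : nat -> R, [/\ q 0%N = 0,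
    forall i, (i < #|X|)%N -> q i.+1 = Num.max (q i) (k (nth r l i)) &
    forall i, (#|X| <= i)%N -> q i.+1 = q i].
  exists (fix q i := if i is j.+1
    then if (j < #|X|)%N then Num.max (q j) (k (nth r l j)) else q j else 0).
  by split=> //= i; [move=> -> | rewrite leqNgt => /negPf ->].
have sz : size l = #|X| by rewrite size_sort -cardE.
have memX u : (u \in l) = (u \in X) by rewrite mem_sort mem_enum.
have q0 i : 0 <= q i.
  elim: i => [|i IH]; first by rewrite q00.
  by have [/q_past ->|/qS ->] := leqP #|X| i; rewrite ?le_max ?IH.
have sl : sorted le_dep l by apply: sort_sorted => u v; exact: leq_total.
have tr : transitive le_dep by move=> a b d; exact: leq_trans.
have sumX (F : V -> R) : \sum_(u in X) F u = \sum_(i < #|X|) F (nth r l i).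
  rewrite -sz -(big_mkord xpredT (fun i => F (nth r l i))) -(big_nth r xpredT).
  have pl : perm_eq l (enum X) by rewrite perm_sort.
  by rewrite (perm_big _ pl) big_enum.
have q_mono i j : (i <= j)%N -> q i <= q j.
  move/subnKC <-; elim: (j - i)%N => [|m IH]; first by rewrite addn0.
  by rewrite addnS; apply: le_trans IH _; have [/q_past ->|/qS ->] := leqP #|X| (i + m)%N;
    rewrite ?le_max lexx.
have parq i : (i < #|X|)%N -> k (par (nth r l i)) <= q i.
  move=> iX; set u := nth r l i.
  have uX : u \in X by rewrite -memX mem_nth ?sz.
  have ur : u != r.
    apply: contraTneq uX => ->; rewrite inE; apply/negP => /andP [/(ancestor_root rt) ->].
    by rewrite eqxx.
  have [->|kp] := eqVneq (k (par u)) 0; first exact: q0.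
  have pX := kX _ kp; have jl : par u \in l by rewrite memX.
  set j := index (par u) l; have jX : (j < #|X|)%N by rewrite -sz index_mem.
  have ij : (j < i)%N.
    rewrite ltnNge; apply/negP => ij.
    have := sorted_leq_nth tr (fun v => leqnn (dep v)) r sl.
    move=> /(_ i j); rewrite !inE sz => /(_ iX jX ij).
    by rewrite /le_dep nth_index // -/u (rooted_dep rt ur) ltnn.
  apply: le_trans (q_mono _ _ ij); rewrite qS // nth_index //.
  by rewrite le_max lexx orbT.
exists q; split=> // N XN.
rewrite -(subnKC XN) !big_split_ord /=; split.
- rewrite [X in _ + X]big1 ?addr0 => [|i _]; last first.
    by rewrite q_past ?leq_addr // subrr expr0n.
  apply: (@le_trans _ _ (\sum_(u in X) (k u - k (par u)) ^+ 2)).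
    rewrite sumX; apply: ler_sum => i _; rewrite qS //.
    have := parq i (ltn_ord i); set a := k (par _); set b := k _ => aq.
    rewrite /Num.max; case: ltP => qb; last by rewrite subrr expr0n sqr_ge0.
    by rewrite ler_pXn2r ?nnegrE ?subr_ge0 ?lerB ?(ltW qb) // (le_trans aq (ltW qb)).
  rewrite (rooted_lap_form rt) [leRHS](bigID (mem X)) /=.
  rewrite -[leLHS]addr0; apply: lerD; last by apply: sumr_ge0 => u _; exact: sqr_ge0.
  rewrite le_eqVlt; apply/orP; left; apply/eqP; apply: eq_bigl => u.
  case: (boolP (u \in X)) => uX; rewrite ?andbF // andbT; apply/esym.
  apply: contraTneq uX => ->; rewrite inE; apply/negP => /andP [/(ancestor_root rt) ->].
  by rewrite eqxx.
- rewrite -[leLHS]addr0; apply: lerD; last by apply: sumr_ge0 => i _; rewrite sqr_ge0.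
  apply: (@le_trans _ _ (\sum_(u in X) k u ^+ 2)).
    rewrite [leRHS]big_mkcond; apply: ler_sum => u _; case: ifP => [_|/negbT uX].
      by rewrite expr2.
    by have [->|/kX] := eqVneq (k u) 0; [rewrite mul0r | rewrite (negPf uX)].
  rewrite sumX; apply: ler_sum => i _; rewrite qS //.
  have := q0 i; have := k0 (nth r l i); set a := q i; set b := k _ => b0 a0.
  by rewrite ler_pXn2r ?nnegrE ?le_max ?a0 // lexx orbT.
Qed.

End Descendants.

(** * The pathified tree *)

Section Pathification.
Variables (V : finType) (e : rel V) (s : V) (par : V -> V) (dep : V -> nat).
Hypothesis rt : rooted_tree e s par dep.
Variables (c : V).
Hypothesis cs : c != s.

Local Notation B := (branch e s c).
Local Notation Vp := (pathif_vertex e s c).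
Local Notation ep := (pathif e s c).

Definition pathif_root : {x : V | x \notin B} := exist _ s (root_notin_branch rt cs).

Definition pathif_parent (u : Vp) : Vp :=
  match u with
  | inl w => inl (insubd pathif_root (par (val w)))
  | inr i => if i == 0%N :> nat then inl pathif_root
             else inr (Ordinal (leq_ltn_trans (leq_pred i) (ltn_ord i)))
  end.

Definition pathif_depth (u : Vp) : nat :=
  match u with inl w => dep (val w) | inr i => i.+1 end.

Lemma pathif_parent_inl (w : {x : V | x \notin B}) : sval (insubd pathif_root (par (sval w))) = par (sval w).
Proof. by rewrite -!/(val _) insubdK //; exact: (parent_notin_branch rt cs (valP w)). Qed.

Lemma pathif_rooted : rooted_tree ep (inl pathif_root) pathif_parent pathif_depth.
Proof.
have inl_eq (a b : {x : V | x \notin B}) : (inl a == inl b :> Vp) = (sval a == sval b) by [].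
have inr_eq (a b : 'I_#|B|) : (inr a == inr b :> Vp) = (a == b :> nat) by [].
split.
- move=> [w|i] [v|j]; rewrite ?inl_eq ?inr_eq /=.
  + by rewrite !pathif_parent_inl; exact: (rooted_edge rt).
  + by rewrite (_ : (inr j == inl _) = false) // andbF; case: (eqVneq (j : nat) 0%N) => j0; rewrite ?inl_eq ?andbF ?andbT.
  + by rewrite (_ : (inr i == inl _) = false) // andbF orbF; case: (eqVneq (i : nat) 0%N) => i0; rewrite ?inl_eq ?andbF ?andbT.
  + case: (eqVneq (i : nat) 0%N) => i0; case: (eqVneq (j : nat) 0%N) => j0; rewrite ?inr_eq /=.
    * by rewrite i0 j0.
    * by rewrite i0; move: (j : nat) j0 => [|[|?]].
    * by rewrite j0; move: (i : nat) i0 => [|[|?]].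
    * by move: (i : nat) (j : nat) i0 j0 => [|a] [|b] //= _ _; rewrite !eqSS orbC.
- congr inl; apply: val_inj; apply: etrans (pathif_parent_inl pathif_root) _.
  by have [_ -> _ _] := rt.
- by have [_ _ d0 _] := rt.
- move=> [w|i]; rewrite ?inl_eq /=.
    by rewrite pathif_parent_inl; exact: (rooted_dep rt).
  by case: eqVneq => [->|i0] _ /=; [have [_ _ -> _] := rt | rewrite prednK // lt0n].
Qed.

Section Functions.
Variable R : realFieldType.

(* Functions on the pathification are pairs of a function on the old vertices and a
   sequence p along the path, with p 0 the value at s and p (i + 1) at [inr i]. *)
Definition pathif_fun (x : V -> R) (p : nat -> R) (u : Vp) : R :=
  match u with inl w => x (val w) | inr i => p i.+1 end.

Lemma pathif_funK (z : Vp -> R) : exists x p,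
  [/\ z =1 pathif_fun x p, p 0%N = x s & forall i, (#|B| < i)%N -> p i = 0].
Proof.
pose x v := if insub v is Some w then z (inl w) else 0.
pose p i := if i is j.+1 then (if insub j is Some k then z (inr k) else 0) else x s.
exists x, p; split=> // [[w|i]|[//|i] Bi] /=; rewrite ?/x ?valK //.
by rewrite insubF //= ltnNge -ltnS Bi.
Qed.

Lemma sum_pathif (f : V -> R) (g : nat -> R) :
  \sum_(u : Vp) (match u with inl w => f (val w) | inr i => g i end) =
  \sum_(w | w \notin B) f w + \sum_(i < #|B|) g i.
Proof.
rewrite big_sumType /=; congr (_ + _).
by rewrite -(big_sub (fun w => w \notin B) f).
Qed.

Lemma pathif_dot x p : dot (pathif_fun x p) (pathif_fun x p) =
  \sum_(w | w \notin B) x w ^+ 2 + \sum_(i < #|B|) p i.+1 ^+ 2.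
Proof.
rewrite -(sum_pathif (fun w => x w ^+ 2) (fun i => p i.+1 ^+ 2)).
by apply: eq_bigr => -[w|i] _ /=; rewrite expr2.
Qed.

Lemma sum_pathif_edges x p (f : R -> R -> R) : p 0%N = x s ->
  \sum_(u | u != inl pathif_root) f (pathif_fun x p u) (pathif_fun x p (pathif_parent u)) =
  \sum_(w | (w \notin B) && (w != s)) f (x w) (x (par w)) +
  \sum_(i < #|B|) f (p i.+1) (p i).
Proof.
move=> p0; rewrite big_mkcondr /= -(sum_pathif (fun w =>
  if w != s then f (x w) (x (par w)) else 0) (fun i => f (p i.+1) (p i))) big_mkcond /=.
apply: eq_bigr => -[w|i] _ /=; first by rewrite pathif_parent_inl.
case: eqVneq => [->|i0] /=; first by rewrite -p0.
by rewrite prednK // lt0n.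
Qed.

Lemma pathif_lap x p : p 0%N = x s -> qform (lapk R ep) (pathif_fun x p) =
  \sum_(w | (w \notin B) && (w != s)) (x w - x (par w)) ^+ 2 +
  \sum_(i < #|B|) (p i.+1 - p i) ^+ 2.
Proof.
by move=> p0; rewrite (rooted_lap_form pathif_rooted) (sum_pathif_edges (fun a b => (a - b) ^+ 2)).
Qed.

Lemma pathif_adj x p : p 0%N = x s -> qform (adjk R ep) (pathif_fun x p) =
  2 * (\sum_(w | (w \notin B) && (w != s)) x w * x (par w) +
       \sum_(i < #|B|) p i.+1 * p i).
Proof.
by move=> p0; rewrite (rooted_adj_form pathif_rooted) (sum_pathif_edges (fun a b => a * b)).
Qed.

End Functions.
End Pathification.

(** * The characteristic set *)

Section CharacteristicSet.
Variables (R : realType) (V : finType) (e : rel V).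
Hypothesis syme : symmetric e.
Variables (X : {set V}) (y h : V) (mu : R).
Hypotheses (cX : connected_set e X) (yX : y \notin X) (hX : h \in X) (hy : e h y).
Hypothesis exitX : forall u v, u \in X -> v \notin X -> e u v -> v = y.
Hypothesis ge_mu : forall z, (forall u, u \notin X -> z u = 0) ->
  mu * dot z z <= qform (lapk R e) z.

Let D u : R := (degree e u)%:R - mu.

Lemma app_schrod_lap x u : app (schrodk e D) x u = app (lapk R e) x u - mu * x u.
Proof.
rewrite app_schrodk app_lapk sumrB sumr_neighbors /D mulrBl; ring.
Qed.

Lemma qform_schrod_lap x : qform (schrodk e D) x = qform (lapk R e) x - mu * dot x x.
Proof.
rewrite /qform /dot mulr_sumr -sumrB; apply: eq_bigr => u _.
by rewrite app_schrod_lap; ring.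
Qed.

Lemma schrod_lap_ge0 z : (forall u, u \notin X -> z u = 0) -> 0 <= qform (schrodk e D) z.
Proof. by move=> /ge_mu; rewrite qform_schrod_lap subr_ge0. Qed.

Variable g : V -> R.
Hypothesis eig : app (lapk R e) g =1 (fun u => mu * g u).

Let gX u := if u \in X then g u else 0.

Lemma app_schrod_restr u : u \in X ->
  app (schrodk e D) gX u = if e u y then g y else 0.
Proof.
move=> uX; have := app_schrod_lap g u; rewrite eig subrr !app_schrodk /gX uX => /eqP.
rewrite subr_eq0 => /eqP ->; rewrite -sumrB.
case: ifP => [uy|/negP uy].
  rewrite (bigD1 y) //= (negPf yX) subr0 big1 ?addr0 // => v /andP [uv vy].
  have [vX|vX] := boolP (v \in X); first by rewrite subrr.
  by rewrite (exitX uX vX uv) eqxx in vy.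
rewrite big1 // => v uv; have [vX|vX] := boolP (v \in X); first by rewrite subrr.
by case: uy; rewrite -(exitX uX vX uv).
Qed.

Lemma eigenfunction_pos : 0 < g y -> forall u, u \in X -> 0 < g u.
Proof.
move=> gy; pose n u := if u \in X then Num.max 0 (- g u) else 0.
pose p u := if u \in X then Num.max 0 (g u) else 0.
have n0 u : 0 <= n u by rewrite /n; case: ifP => // _; rewrite le_max lexx.
have p0 u : 0 <= p u by rewrite /p; case: ifP => // _; rewrite le_max lexx.
have np u : n u * p u = 0.
  rewrite /n /p; case: ifP => _; rewrite ?mul0r // /Num.max.
  by case: ltP => h1; case: ltP => h2; rewrite ?mul0r ?mulr0 //; lra.
have gpn u : gX u = lin 1 p (-1) n u.
  rewrite /gX /lin /n /p; case: ifP => _; last by ring.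
  by rewrite /Num.max; case: ltP => h1; case: ltP => h2; lra.
have nX u : u \notin X -> n u = 0 by rewrite /n => /negPf ->.
have npneg : dot n (app (schrodk e D) p) <= 0.
  rewrite -oppr_ge0 /dot -sumrN; apply: sumr_ge0 => u _.
  rewrite app_schrodk mulrBr mulrCA np mulr0 sub0r opprK.
  by rewrite mulr_ge0 // sumr_ge0.
have ngX : dot n (app (schrodk e D) gX) = \sum_(u in X | e u y) n u * g y.
  rewrite /dot [RHS]big_mkcond; apply: eq_bigr => u _.
  have [uX|uX] /= := boolP (u \in X); last by rewrite nX ?mul0r.
  by rewrite app_schrod_restr //; case: ifP => _; rewrite ?mulr0.
have qn : qform (schrodk e D) n = dot n (app (schrodk e D) p) - \sum_(u in X | e u y) n u * g y.
  rewrite -ngX (eq_dot (fun u => erefl) (fun u => eq_app _ gpn u)).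
  rewrite (eq_dot (fun u => erefl) (app_lin _ _ _ _ _)) dot_linr /qform; ring.
have sum0 : 0 <= \sum_(u in X | e u y) n u * g y.
  by apply: sumr_ge0 => u _; rewrite mulr_ge0 // ltW.
have qn0 := schrod_lap_ge0 nX.
have n_zero u : n u = 0.
  have [|//|npos|nneg] := schrod_kernel_sign syme cX schrod_lap_ge0 nX.
  - lra.
  - suff : 0 < \sum_(u in X | e u y) n u * g y by lra.
    rewrite (bigD1 h) ?hX //=; apply: ltr_wpDr; last by rewrite mulr_gt0 // npos.
    by apply: sumr_ge0 => v _; rewrite mulr_ge0 // ltW.
  - by have := nneg h hX; rewrite ltNge n0.
have g0 u : u \in X -> 0 <= g u.
  move=> uX; have := n_zero u; rewrite /n uX => m0.
  by rewrite -oppr_le0 -m0 le_max lexx orbT.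
move=> u uX; rewrite lt_neqAle g0 // andbT eq_sym; apply/eqP => gu.
have [|v w vX vw|_ nb] := @schrod_zero_spreads R V e D X g u h cX _ _ uX gu hX.
- by move=> v _; rewrite app_schrod_lap eig subrr.
- have [wX|wX] := boolP (w \in X); first exact: g0.
  by rewrite (exitX vX wX vw) ltW.
by have := nb y hy; move: gy => /[swap] ->; rewrite ltxx.
Qed.

Lemma eigenfunction_zero : g y = 0 ->
  (forall u, u \in X -> g u = 0) \/ (forall u, u \in X -> g u != 0).
Proof.
move=> gy; have gX0 u : u \notin X -> gX u = 0 by rewrite /gX => /negPf ->.
have q0 : qform (schrodk e D) gX = 0.
  rewrite /qform /dot big1 // => u _; have [uX|/gX0 ->] := boolP (u \in X).
    by rewrite app_schrod_restr // gy if_same mulr0.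
  by rewrite mul0r.
have gE u : u \in X -> gX u = g u by rewrite /gX => ->.
have [z|z|z] := schrod_kernel_sign syme cX schrod_lap_ge0 gX0 q0.
- by left=> u uX; rewrite -gE.
- by right=> u uX; rewrite -gE // gt_eqF // z.
- by right=> u uX; rewrite -gE // lt_eqF // z.
Qed.

End CharacteristicSet.

Section CharacteristicSetLocation.
Variables (R : realType) (V : finType) (e : rel V).
Hypothesis syme : symmetric e.
Variables (X : {set V}) (y h : V).
Hypotheses (cX : connected_set e X) (yX : y \notin X) (hX : h \in X) (hy : e h y).
Hypothesis exitX : forall u v, u \in X -> v \notin X -> e u v -> v = y.
Hypothesis ge_mu : forall z, (forall u, u \notin X -> z u = 0) ->
  mu2 R e * dot z z <= qform (lapk R e) z.

Lemma charset_avoids (C : {set V}) : charset R e C -> forall v, v \in C -> v \notin X.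
Proof.
move=> [f /fiedler_app eig]; set g := entry f in eig *.
have sgn u : g y != 0 -> u \in X -> 0 < g u * g y.
  rewrite neq_lt => /orP [gy|gy] uX; last first.
    by rewrite mulr_gt0 // (eigenfunction_pos syme cX yX hX hy exitX ge_mu eig).
  rewrite -mulrNN mulr_gt0 ?oppr_gt0 // -oppr_gt0.
  apply: (eigenfunction_pos syme cX yX hX hy exitX ge_mu (g := fun v => - g v) _ _ uX).
    move=> v; rewrite mulrN -eig app_lapk app_lapk -sumrN.
    by apply: eq_bigr => w _; ring.
  by rewrite oppr_gt0.
have nbX u v : u \in X -> e u v -> v \in X \/ v = y.
  move=> uX uv; have [vX|vX] := boolP (v \in X); first by left.
  by right; exact: exitX uX vX uv.
case=> [[_ [v [w [vw gv /eqP gw ->]]]]|[gn [u [v [uv gu gv ->]]]]] a.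
  move=> /set1P ->; apply/negP => vX.
  have [gy|gy] := eqVneq (g y) 0; last by have := sgn v gy vX; rewrite /g gv mul0r ltxx.
  have [z|z] := eigenfunction_zero syme cX yX exitX ge_mu eig gy; last first.
    by have := z v vX; rewrite /g gv eqxx.
  by case: (nbX _ _ vX vw) => [wX|wy]; move: gw; rewrite -/(g w) ?wy ?gy ?z ?eqxx.
have gy : g y != 0 by apply/eqP; exact: gn.
have same w : w \in X \/ w = y -> 0 < g w * g y.
  by case=> [|->]; [exact: sgn | rewrite -expr2 exprn_even_gt0].
have opp w w' : w \in X -> e w w' -> 0 < g w * g w'.
  move=> wX ww'; have := same _ (nbX _ _ wX ww'); have := sgn w gy wX.
  move=> h1 h2; have := mulr_gt0 h1 h2; rewrite mulrACA -expr2 pmulr_lgt0 //.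
  by rewrite exprn_even_gt0.
have neg : g u * g v < 0 by rewrite nmulr_llt0.
move=> /set2P [] ->; apply/negP => wX.
  by have := lt_trans neg (opp _ _ wX uv); rewrite ltxx.
have vu : e v u by rewrite syme.
by have := opp _ _ wX vu; rewrite mulrC => /(lt_trans neg); rewrite ltxx.
Qed.

End CharacteristicSetLocation.

Section LaplacianSide.
Variables (R : realType) (V : finType) (e : rel V) (s : V) (par : V -> V) (dep : V -> nat).
Hypothesis rt : rooted_tree e s par dep.
Variables (c : V) (k : V -> R) (w0 : V).
Hypothesis cs : c != s.
Hypotheses (k0 : forall u, 0 <= k u) (kw : k w0 != 0).
Hypothesis kX : forall u, k u != 0 -> u \in strict_descendants par c.
Hypothesis le_k : qform (lapk R e) k <= mu2 R e * dot k k.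

Local Notation anc := (fconnect par).
Local Notation B := (branch e s c).
Local Notation ep := (pathif e s c).

Lemma tree_gt1 : (1 < #|V|)%N.
Proof. by apply/card_gt1P; exists c, s. Qed.

Lemma pathif_gt1 : (1 < #|pathif_vertex e s c|)%N.
Proof.
have B0 : (0 < #|B|)%N by apply/card_gt0P; exists c; rewrite inE connect0.
by apply/card_gt1P; exists (inl (pathif_root rt cs)), (inr (Ordinal B0)).
Qed.

Lemma mu2_le_nondescendants z : (forall u, anc u c -> z u = 0) ->
  mu2 R e * dot z z <= qform (lapk R e) z.
Proof.
move=> z0; apply: (mu2_le_apart (rooted_sym rt) tree_gt1 k0 _ _ le_k); first by exists w0.
move=> a b za /kX bX; have na : ~~ anc a c by apply: contra za => /z0 ->.
move: (bX); rewrite inE => /andP [bc bNc]; apply/andP; split.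
  by apply: contraNneq na => ->.
apply/negP; rewrite (rooted_edge rt) => /orP [] /andP [_ /eqP E].
  by move: na; rewrite ancestorE -E bc orbT.
by move: bc; rewrite ancestorE (negPf bNc) -E (negPf na).
Qed.

Lemma mu2_ge0 : 0 <= mu2 R e.
Proof.
have nk : 0 < dot k k by exact: dot_gt0 kw.
by have := le_trans (form_lapk_ge0 (rooted_sym rt) k) le_k; rewrite pmulr_lge0.
Qed.

Lemma dep_branch : (dep c < #|B|)%N.
Proof.
apply: leq_trans (card_strict_descendants rt cs); rewrite -add1n leq_add2r.
by apply/card_gt0P; exists w0; exact: kX.
Qed.

(* The old vertices together with y_1, ..., y_(d-1). *)
Definition near_side : {set pathif_vertex e s c} :=
  [set u : pathif_vertex e s c | if u is inr i then (i.+1 < dep c)%N else true].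

Lemma pathif_mu2_le_near_side z : (forall u, u \notin near_side -> z u = 0) ->
  mu2 R ep * dot z z <= qform (lapk R ep) z.
Proof.
move=> z0; rewrite leNgt; apply/negP => lt_z.
have rtp := pathif_rooted rt cs; have dB := dep_branch.
have [q [q00 q0 q_lap]] := path_rearrangement rt k0 kX.
pose p' i := q (i - dep c)%N; pose kp : pathif_vertex e s c -> R := pathif_fun (fun _ => 0) p'.
have sumB (F : nat -> R) : (forall i, (i < dep c)%N -> F i = 0) ->
    \sum_(i < #|B|) F i = \sum_(i < #|B| - dep c) F (dep c + i)%N.
  move=> F0; rewrite -[in LHS](subnKC (ltnW dB)) big_split_ord /=.
  by rewrite big1 ?add0r // => i _; exact: F0.
have [lap_q dot_q] : qform (lapk R ep) kp <= qform (lapk R e) k /\ dot k k <= dot kp kp.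
  have := q_lap (#|B| - dep c)%N.
  have cX := card_strict_descendants rt cs; case; first by lia.
  move=> h1 h2; split.
    rewrite (pathif_lap rt cs) ?/p' // big1 => [|u _]; last by rewrite subrr expr0n.
    rewrite add0r (sumB (fun i => (p' i.+1 - p' i) ^+ 2)) /p' => [|i id].
      apply: le_trans h1; rewrite le_eqVlt; apply/orP; left; apply/eqP.
      by apply: eq_bigr => i _; rewrite -addnS !addKn.
    have [-> ->] : (i.+1 - dep c = 0 /\ i - dep c = 0)%N by lia.
    by rewrite q00 subrr expr0n.
  rewrite pathif_dot big1 => [|u _]; last by rewrite expr0n.
  rewrite add0r (sumB (fun i => p' i.+1 ^+ 2)) /p' => [|i id].
    apply: le_trans h2 _; rewrite le_eqVlt; apply/orP; left; apply/eqP.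
    by apply: eq_bigr => i _; rewrite /p' -addnS addKn.
  by have -> : (i.+1 - dep c = 0)%N; [lia | rewrite q00 expr0n].
have nk : 0 < dot k k by exact: dot_gt0 kw.
have mu0 := mu2_ge0; have [le_mu|lt_mu] := leP (mu2 R e) (mu2 R ep).
  move: lt_z; rewrite ltNge => /negP; apply.
  apply: (mu2_le_apart (rooted_sym rtp) pathif_gt1 (k := kp)).
  - by move=> [v|i] /=; [exact: lexx | exact: q0].
  - apply/existsP; apply: contraTT (lt_le_trans nk dot_q) => /existsPn kp0.
    rewrite /dot big1 ?ltxx // => u _.
    by have := kp0 u; rewrite negbK => /eqP ->; rewrite mul0r.
  - move=> a b za; have : a \in near_side by apply: contraR za => /z0 ->.
    case: b => [b|j]; rewrite /kp /= ?eqxx // /p' => aH qj.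
    have jd : (dep c <= j)%N.
      rewrite leqNgt; apply: contra qj => jd.
      by have -> : (j.+1 - dep c = 0)%N; [lia | rewrite q00].
    have d0 : (0 < dep c)%N by rewrite (rooted_dep rt cs).
    case: a aH za => [a|i]; rewrite inE => aH _.
      by rewrite /= negb_and; apply/orP; right; lia.
    have ij : (i != j :> nat)%N by lia.
    apply/andP; split; first by apply: contra ij => /eqP [->].
    by rewrite /= negb_or; lia.
  - apply: le_trans lap_q (le_trans le_k _).
    have := ler_wpM2r (ltW nk) le_mu; have := ler_wpM2l (le_trans mu0 le_mu) dot_q; lra.
have [x [p [zE p0 _]]] := pathif_funK z.
have pz i : (i < #|B|)%N -> (dep c <= i.+1)%N -> p i.+1 = 0.
  move=> iB di; have := zE (inr (Ordinal iB)); rewrite /= => <-; apply: z0.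
  by rewrite inE /= -leqNgt.
pose p1 i := if (i < dep c)%N then p i else 0.
have d0 : (0 < dep c)%N by rewrite (rooted_dep rt cs).
have p1E i : (i <= #|B|)%N -> p1 i = p i.
  rewrite /p1; case: ltnP => // di iB; case: i di iB => [|i] di iB; first by lia.
  by rewrite pz.
have p10 : p1 0%N = x s by rewrite p1E.
have p1d i : (dep c <= i)%N -> p1 i = 0 by rewrite /p1 leqNgt => /negPf ->.
have [zt [zt0 ztq ztd]] := unproject rt cs p10 p1d.
have sumd (F : nat -> R) : (forall i, (dep c <= i)%N -> F i = 0) ->
    \sum_(i < #|B|) F i = \sum_(i < dep c) F i.
  move=> F0; rewrite -[in LHS](subnKC (ltnW dB)) big_split_ord /= [X in _ + X]big1 ?addr0 // => i _.
  by rewrite F0 // leq_addr.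
have qz : qform (lapk R e) zt = qform (lapk R ep) z.
  rewrite ztq (eq_form _ zE) (pathif_lap rt cs) //; congr (_ + _).
  rewrite -(sumd (fun i => (p1 i.+1 - p1 i) ^+ 2)) => [|i di].
    by apply: eq_bigr => i _; rewrite !p1E // ltnW.
  by rewrite !p1d ?subrr ?expr0n // ltnW.
have dz : dot z z <= dot zt zt.
  apply: le_trans ztd; rewrite (eq_dot zE zE) pathif_dot lerD2l.
  rewrite -(sumd (fun i => p1 i.+1 ^+ 2)) => [|i di].
    by rewrite le_eqVlt; apply/orP; left; apply/eqP; apply: eq_bigr => i _; rewrite p1E.
  by rewrite p1d ?expr0n // ltnW.
have := mu2_le_nondescendants zt0; rewrite qz.
have := ler_wpM2l mu0 dz; have := ler_wpM2r (dot_ge0 z) (ltW lt_mu); lra.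
Qed.

Lemma pathif_charset (C' : {set pathif_vertex e s c}) : charset R ep C' ->
  forall v, v \in C' -> v \notin near_side.
Proof.
have rtp := pathif_rooted rt cs; have dB := dep_branch.
have d0 : (0 < dep c)%N by rewrite (rooted_dep rt cs).
have yB : ((dep c).-1 < #|B|)%N by lia.
pose y : pathif_vertex e s c := inr (Ordinal yB).
have parX u : u \in near_side -> pathif_parent rt cs u \in near_side.
  case: u => [v|i]; first by rewrite !inE.
  rewrite /=; case: eqP => [_|i0]; rewrite !inE //=; lia.
have yN : y != inl (pathif_root rt cs) by [].
have hX : pathif_parent rt cs y \in near_side.
  rewrite /=; case: eqP => [_|i0]; rewrite !inE //=; lia.
apply: (charset_avoids (rooted_sym rtp) (y := y) (h := pathif_parent rt cs y)) => //.
- exact: (rooted_connected_set rtp parX).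
- by rewrite inE /= prednK // ltnn.
- by rewrite (rooted_sym rtp) (rooted_parent rtp).
- move=> u v uX vX; rewrite (rooted_edge rtp) => /orP [] /andP [ur /eqP E].
    by move: vX; rewrite E parX.
  case: v vX ur E => [v|j]; rewrite inE //= => jd _.
  case: eqVneq => [j0 _|j0 E]; congr inr; apply: val_inj => /=; first by lia.
  by move: uX; rewrite E inE /=; lia.
- exact: pathif_mu2_le_near_side.
Qed.

End LaplacianSide.

(** * The spectral center *)

Lemma path_sum_map (R : realFieldType) (p : nat -> R) j n :
  path_sum (p j) [seq p i | i <- iota j.+1 n] = \sum_(i < n) p (j + i)%N * p (j + i).+1.
Proof.
elim: n j => [|n IH] j /=; first by rewrite big_ord0.
rewrite big_ord_recl addn0 IH; congr (_ + _).
by apply: eq_bigr => i _; rewrite /= /bump /= add1n addnS addSn.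
Qed.

Section CenterSide.
Variables (R : realType) (V : finType) (e : rel V) (s : V) (par : V -> V) (dep : V -> nat).
Hypothesis rt : rooted_tree e s par dep.
Variable c : V.
Hypothesis cs : c != s.

Local Notation anc := (fconnect par).
Local Notation B := (branch e s c).
Local Notation Vp := (pathif_vertex e s c).
Local Notation ep := (pathif e s c).
Local Notation sp := (inl (pathif_root rt cs) : Vp).

Let rtp := pathif_rooted rt cs.

Lemma subtree_avoids_branch (S : {set V}) v1 : is_subtree e S -> s \in S ->
  anc c v1 -> v1 != s -> par v1 = s -> v1 \notin S -> [disjoint B & S].
Proof.
move=> /andP [_ cS] sS cv v1s pv v1S; have bE := branchE rt cv v1s pv.
rewrite disjoint_subset; apply/subsetP => u uB; apply/negP => uS.
have cus := forall_inP (forall_inP cS u uS) s sS.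
suff : s \in B by rewrite (negPf (root_notin_branch rt cs)).
apply: (connect_invariant (P := fun v => v \in B) _ uB cus) => a b aB /and3P [aS bS ab].
apply: contraT => bB; have bs := branch_exit rt cs aB bB ab.
have as_ := branch_neq_root rt cs aB.
move: aB ab; rewrite bE bs (rooted_edge rt) as_ eqxx /= orbF ancestorE => av /eqP pa.
move: av; rewrite -pa => /orP [/eqP a1|/(ancestor_root rt) /eqP].
  by rewrite a1 (negPf v1S) in aS.
by rewrite (negPf v1s).
Qed.

Hypothesis le_B : forall x : V -> R, (forall u, u \notin B -> x u = 0) ->
  qform (adjk R e) x <= lambda2 R e * dot x x.

Lemma lambda2_path z : (forall w, z (inl w) = 0) ->
  qform (adjk R ep) z <= lambda2 R ep * dot z z.
Proof.
move=> z0; rewrite leNgt; apply/negP => lt_z.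
pose a u := `|z u|; set l := lambda2 R ep in lt_z.
have da : dot a a = dot z z.
  by apply: eq_bigr => u _; rewrite -normrM ger0_norm // -expr2 sqr_ge0.
have lt_a : l * dot a a < qform (adjk R ep) a.
  have := schrod_form_norm ep (fun _ => 0) z; rewrite !schrod_form_adj !mul0r !sub0r lerN2.
  by rewrite da; apply: lt_le_trans.
have [u0 au0] : exists u, a u != 0.
  apply/existsP; apply: contraTT lt_a => /existsPn a0; rewrite -leNgt.
  have a00 u : a u = 0 by have := a0 u; rewrite negbK => /eqP.
  by rewrite /qform /dot !big1 ?mulr0 // => u _; rewrite a00 mul0r.
have ppos : 0 < dot a a by exact: dot_gt0 au0.
pose r := qform (adjk R ep) a / dot a a.
have lr : l < r by rewrite ltr_pdivlMr.
have ra : r * dot a a = qform (adjk R ep) a by rewrite divfK // gt_eqF.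
have [x [p [aE p0 pB]]] := pathif_funK a.
have x0 w : w \notin B -> x w = 0.
  by move=> wB; have := aE (inl (exist _ w wB)); rewrite /= /a z0 normr0 => <-.
have p00 : p 0%N = 0 by rewrite p0 x0 // (root_notin_branch rt cs).
have p_ge0 i : 0 <= p i.
  case: i => [|i]; first by rewrite p00.
  have [iB|iB] := ltnP i #|B|; last by rewrite pB.
  by have := aE (inr (Ordinal iB)); rewrite /= => <-; exact: normr_ge0.
have qa : qform (adjk R ep) a = 2 * \sum_(i < #|B|) p i.+1 * p i.
  rewrite (eq_form _ aE) (pathif_adj rt cs) // big1 ?add0r // => w /andP [wB _].
  by rewrite x0 ?mul0r.
have dp : dot a a = \sum_(i < #|B|) p i.+1 ^+ 2.
  by rewrite (eq_dot aE aE) pathif_dot big1 ?add0r // => w wB; rewrite x0 ?expr0n.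
have B0 : (0 < #|B|)%N by apply/card_gt0P; exists c; rewrite inE connect0.
pose t := [seq p i | i <- iota 2 #|B|.-1].
have tE : p 1%N :: t = [seq p i | i <- iota 1 #|B|] by rewrite -[in RHS](prednK B0).
have [||y [y0 ny qy]] := @path_le_connected R V e (rooted_sym rt) (rooted_irr rt) (p 1%N) t B _
    (branch_connected rt cs).
- by rewrite tE all_map; apply/allP => i _; exact: p_ge0.
- by rewrite tE size_map size_iota.
have nya : dot y y = dot a a.
  rewrite ny tE dp big_map.
  have -> : iota 1 #|B| = index_iota 1 #|B|.+1 by rewrite /index_iota subSS subn0.
  by rewrite big_add1 big_mkord.
have qya : qform (adjk R ep) a <= qform (adjk R e) y.
  apply: le_trans qy; rewrite qa path_sum_map -[in leLHS](prednK B0) big_ord_recl p00 mulr0 add0r.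
  rewrite le_eqVlt; apply/orP; left; apply/eqP; congr (_ * _).
  by apply: eq_bigr => i _; rewrite mulrC /= /bump /= !add1n.
have r_le : r <= lambda2 R e.
  rewrite -(ler_pM2r ppos) ra -nya; apply: le_trans qya _; exact: le_B.
have [v1 [cv v1s pv]] := branch_top rt cs.
apply: (lambda2_cut_vertex (rooted_sym rt) (s := s) (y1 := v1) (Y := B)) le_B _.
- by apply/card_gt1P; exists c, s.
- exact: (root_notin_branch rt cs).
- by rewrite (branchE rt cv v1s pv) connect0.
- by rewrite (rooted_sym rt) -pv (rooted_parent rt).
- by move=> u v; exact: (branch_exit rt cs).
- exact: (branch_connected rt cs).
move=> xt xtB xts le_xt v; apply/eqP; apply: contraT => xtv.
pose xh : Vp -> R := pathif_fun xt (fun _ => 0).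
have vB : v \notin B by apply: contra xtv => /xtB ->.
move: lr; rewrite ltNge; move=> /negP; case.
apply: (lambda2_ge_apart (rooted_sym rtp) (x := xh) (y := a)).
- exact: (pathif_gt1 rt cs).
- by exists (inl (exist _ v vB)).
- by exists u0.
- move=> [w|i] [w'|j]; rewrite /xh /a /= ?eqxx ?z0 ?normr0 ?eqxx // => xw _.
  by rewrite negb_and; apply/orP; left; apply: contra xw => /eqP ->; rewrite xts.
- rewrite /xh pathif_dot (pathif_adj rt cs) ?xts //.
  rewrite [X in _ * (_ + X)]big1 ?addr0 => [|i _]; last by rewrite expr0n.
  rewrite [X in _ * (_ + X)]big1 ?addr0 => [|i _]; last by rewrite mul0r.
  have dE : \sum_(w | w \notin B) xt w ^+ 2 = dot xt xt.
    rewrite /dot [RHS](bigID (mem B)) /= [X in _ = X + _]big1 ?add0r => [|w wB].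
      by apply: eq_bigr => w _; rewrite expr2.
    by rewrite xtB ?mul0r.
  have qE : 2 * \sum_(w | (w \notin B) && (w != s)) xt w * xt (par w) = qform (adjk R e) xt.
    rewrite (rooted_adj_form rt) [in RHS](bigID (mem B)) /= [X in _ = _ * (X + _)]big1 ?add0r.
      by congr (_ * _); apply: eq_bigl => w; rewrite andbC.
    by move=> w /andP [_ wB]; rewrite xtB ?mul0r.
  rewrite dE qE; apply: le_trans le_xt; rewrite ler_wpM2r ?dot_ge0 //.
- by rewrite ra.
Qed.

Definition old_vertices : {set Vp} := [set u : Vp | if u is inl _ then true else false].

Lemma old_vertices_connected : connected_set ep old_vertices.
Proof. by apply: (rooted_connected_set rtp) => -[w|i]; rewrite !inE. Qed.

Lemma old_vertices_exit u v : u \notin old_vertices -> v \in old_vertices -> ep u v -> v = sp.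
Proof.
case: u => [w|i]; case: v => [v|j]; rewrite !inE //= => _ _ /andP [/eqP vs _].
by congr inl; apply: val_inj.
Qed.

Lemma induced_radius_path (X : {set Vp}) : X \subset ~: old_vertices ->
  induced_radius R ep X <= lambda2 R ep.
Proof.
move=> /subsetP sX.
have zX (x : Vp -> R) : (forall u, u \notin X -> x u = 0) -> forall w, x (inl w) = 0.
  move=> x0 w; apply: x0; apply/negP => /sX; by rewrite !inE.
apply/(induced_radiusP (rooted_sym rtp) _ _); split; last by move=> x /zX; exact: lambda2_path.
have B0 : (0 < #|B|)%N by apply/card_gt0P; exists c; rewrite inE connect0.
pose y : Vp := inr (Ordinal B0); pose d (u : Vp) : R := (u == y)%:R.
have dd : 0 < dot d d by apply: (dot_gt0 (u := y)); rewrite /d eqxx oner_eq0.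
have := lambda2_path (z := d) (fun w => erefl).
have : 0 <= qform (adjk R ep) d.
  apply: sumr_ge0 => u _; rewrite mulr_ge0 ?ler0n // app_adjk.
  by apply: sumr_ge0 => v _; rewrite ler0n.
by move=> h1 /(le_trans h1); rewrite pmulr_lge0.
Qed.

Lemma induced_radius_sub (X Y : {set Vp}) : X \subset Y ->
  induced_radius R ep Y <= lambda2 R ep -> induced_radius R ep X <= lambda2 R ep.
Proof.
move=> /subsetP sXY /(induced_radiusP (rooted_sym rtp) _ _) [l0 leY].
apply/(induced_radiusP (rooted_sym rtp) _ _); split=> // x x0; apply: leY => u uY.
by apply: x0; apply: contra uY; exact: sXY.
Qed.

Lemma spectral_center_old (S' : {set Vp}) : spectral_center R ep S' -> S' \subset old_vertices.
Proof.
move=> /minsetP [splitS minS]; have := splitS => /andP [/andP [S0 cS] /forallP radS].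
have {}cS : connected_set ep S' by move=> u v uS vS; exact: (forall_inP (forall_inP cS u uS) v vS).
have [dis|meet] := boolP [disjoint S' & old_vertices]; last first.
  apply/setIidPl; apply: minS; last exact: subsetIl.
  have [u0 u0S u0W] : exists2 u, u \in S' & u \in old_vertices.
    by case/pred0Pn: meet => u /andP [uS uW]; exists u.
  pose ret (u : Vp) : Vp := if u is inl _ then u else sp.
  have cI : connected_set ep (S' :&: old_vertices).
    have retK u : u \in old_vertices -> ret u = u by case: u => // ?; rewrite inE.
    move=> u v /setIP [uS uW] /setIP [vS vW]; rewrite -(retK u uW) -(retK v vW).
    have /connectP [q pq ->] := cS u v uS vS.
    elim: q u {uS uW} pq => [u _|w q IH u /= /andP [/and3P [uS wS uw] pq]]; first exact: connect0.
    apply: connect_trans (IH _ pq).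
    case: u uS uw => [u|i] uS; case: w wS {IH pq} => [w|j] wS uw; rewrite /ret.
    - by apply: connect1; apply/and3P; split; rewrite // inE ?uS ?wS inE.
    - have -> : inl u = sp.
        by apply: old_vertices_exit (_ : inr j \notin _) _ _; rewrite ?inE // (rooted_sym rtp).
      exact: connect0.
    - have -> : inl w = sp by apply: old_vertices_exit uw; rewrite inE.
      exact: connect0.
    - exact: connect0.
  apply/andP; split.
    apply/andP; split; first by apply/set0Pn; exists u0; rewrite inE u0S u0W.
    by apply/forall_inP => u uX; apply/forall_inP => v vX; exact: cI.
  apply/forallP => x; apply/implyP; rewrite inE negb_and => xSW.
  have sS t : t \in S' -> t \notin old_vertices -> sp \in S'.
    move=> tS tW; apply: contraT => sS.
    suff : u0 \in ~: old_vertices by rewrite inE u0W.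
    apply: (connect_invariant (P := fun v => v \in ~: old_vertices) _ _ (cS t u0 tS u0S)).
      move=> a b; rewrite !in_setC => aW /and3P [_ bS ab]; apply: contra sS => bW.
      by rewrite -(old_vertices_exit aW bW ab).
    by rewrite inE.
  have [xS|xS] := boolP (x \in S').
    have xW : x \notin old_vertices by move: xSW; rewrite xS.
    apply: induced_radius_path; apply/subsetP => v; rewrite [v \in component _ _ _]inE => xv.
    apply: (connect_invariant (P := fun v => v \in ~: old_vertices) _ _ xv); last by rewrite inE.
    move=> a b; rewrite !in_setC => aW /and3P [_ bI ab]; move: bI; rewrite in_setC; apply: contra => bW.
    by rewrite inE bW (old_vertices_exit aW bW ab) (sS x).
  have [/existsP [t /andP [tS tW]]|noY] := boolP [exists t, (t \in S') && (t \notin old_vertices)].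
    have sS' := sS t tS tW.
    have cross a b : ep a b -> a \notin S' :&: old_vertices -> b \notin S' :&: old_vertices ->
        (a \in old_vertices) = (b \in old_vertices).
      have half a' b' : ep a' b' -> b' \notin S' :&: old_vertices ->
          b' \in old_vertices -> a' \in old_vertices.
        move=> ab bI bW; apply: contraT => aW; move: bI.
        by rewrite inE bW (old_vertices_exit aW bW ab) sS'.
      move=> ab aI bI; apply/idP/idP; last exact: half ab bI.
      by apply: half aI; rewrite (rooted_sym rtp).
    have [xW|xW] := boolP (x \in old_vertices).
      apply: induced_radius_sub (implyP (radS x) xS); apply/subsetP => v.
      rewrite !inE => /connectP [q pq ->].
      elim: q x xS xW {xSW} pq => [x _ _ _|w q IH x xS xW /= /andP [/and3P [xI wI xw] pq]].
        exact: connect0.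
      have wW : w \in old_vertices by rewrite -(cross x w xw) // -in_setC.
      have wS : w \notin S' by move: wI; rewrite in_setC in_setI wW andbT.
      apply: connect_trans (IH w wS wW pq); apply: connect1.
      by apply/and3P; split; rewrite // in_setC.
    apply: induced_radius_path; apply/subsetP => v; rewrite [v \in component _ _ _]inE => xv.
    apply: (connect_invariant (P := fun v => v \in ~: old_vertices) _ _ xv); last by rewrite inE.
    by move=> a b; rewrite !in_setC => aW /and3P [aI bI ab]; rewrite -(cross a b ab) // -in_setC.
  have -> : S' :&: old_vertices = S'.
    apply/setIidPl/subsetP => t tS; apply: contraT => tW; case/negP: noY.
    by apply/existsP; exists t; rewrite tS.
  exact: (implyP (radS x) xS).
have sS : sp \notin S'.
  have sW : sp \in old_vertices by rewrite inE.
  by rewrite (disjointFl dis sW).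
have leW x : (forall u, u \notin old_vertices -> x u = 0) ->
    qform (adjk R ep) x <= lambda2 R ep * dot x x.
  have /(induced_radiusP (rooted_sym rtp) _ _) [_ leC] := implyP (radS sp) sS.
  move=> x0; apply: leC => u uC; apply: x0; apply: contra uC => uW.
  rewrite inE; apply: connect_restrS (old_vertices_connected _ uW); last by rewrite inE.
  by rewrite -disjoints_subset disjoint_sym.
exfalso.
have B0 : (0 < #|B|)%N by apply/card_gt0P; exists c; rewrite inE connect0.
pose y : Vp := inr (Ordinal B0).
apply: (lambda2_cut_vertex (R := R) (rooted_sym rtp) (s := sp) (y1 := y) (Y := ~: old_vertices)).
- exact: (pathif_gt1 rt cs).
- by rewrite !inE.
- by rewrite !inE.
- by rewrite /= eqxx.
- move=> u v; rewrite !in_setC negbK; exact: old_vertices_exit.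
- have to_y u : u \in ~: old_vertices -> connect (restr ep (~: old_vertices)) u y.
    case: u => [w|i]; first by rewrite !inE.
    move=> _; case: i => i; elim: i => [|i IH] iB.
      by have -> : Ordinal iB = Ordinal B0 by apply: val_inj.
    apply: connect_trans (IH (ltnW iB)); apply: connect1.
    by rewrite /restr /= !inE /= eqxx orbT.
  move=> u v /to_y u1 /to_y v1; apply: connect_trans u1 _.
  by rewrite (connect_restr_sym (rooted_sym rtp)).
- by move=> x x0; apply: lambda2_path => w; apply: x0; rewrite !inE.
- move=> x x0 xs le_x.
  have x0' u : u \notin old_vertices -> x u = 0 by move=> uW; apply: x0; rewrite in_setC.
  have q0 : qform (schrodk ep (fun _ => lambda2 R ep)) x = 0.
    by rewrite schrod_form_adj; apply/eqP; rewrite subr_eq0 eq_le le_x leW.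
  have pos z : (forall u, u \notin old_vertices -> z u = 0) ->
      0 <= qform (schrodk ep (fun _ => lambda2 R ep)) z.
    by move=> /leW; rewrite schrod_form_adj subr_ge0.
  have sW : sp \in old_vertices by rewrite inE.
  have [//|h|h] := schrod_kernel_sign (rooted_sym rtp) old_vertices_connected pos x0' q0.
    by have := h sp sW; rewrite xs ltxx.
  by have := h sp sW; rewrite xs ltxx.
Qed.

End CenterSide.

(** * Conclusion *)

Section FiedlerChild.
Variables (R : realType) (V : finType) (e : rel V) (r : V) (par : V -> V) (dep : V -> nat).
Hypothesis rt : rooted_tree e r par dep.
Variables (C : {set V}) (c : V).

Lemma app_opp (M : V -> V -> R) g mu : app M g =1 (fun u => mu * g u) ->
  app M (fun u => - g u) =1 (fun u => mu * - g u).
Proof.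
move=> eig u; rewrite mulrN -eig /app -sumrN.
by apply: eq_bigr => v _; rewrite mulrN.
Qed.

Lemma fiedler_child : charset R e C -> c \in C -> c != r -> par c \notin C ->
  exists g w, [/\ app (lapk R e) g =1 (fun u => mu2 R e * g u), 0 <= g c,
    w != r, par w = c & g w < 0].
Proof.
move=> [f /fiedler_app eig]; set g := entry f in eig *; have eigN := app_opp eig.
case=> [[_ [v [w [vw gv /eqP gw ->]]]]|[_ [u [v [uv gu gv ->]]]]].
  move=> /set1P cv cr _; rewrite -{v}cv -/(g c) in vw gv; rewrite -/(g w) in gw.
  have sum0 : \sum_(v | e c v) g v = 0.
    have := eig c; rewrite app_lapk gv mulr0 sumrB big1 ?sub0r => [|? _]; last by [].
    by move=> /eqP; rewrite oppr_eq0 => /eqP.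
  have [x [xr xc gx]] : exists x, [/\ x != r, par x = c & g x != 0].
    have [/existsP [x /and3P [? /eqP ? ?]]|no] :=
      boolP [exists x, [&& x != r, par x == c & g x != 0]]; first by exists x.
    have gchild x : e c x -> x != par c -> g x = 0.
      move=> cx xp; apply/eqP; apply: contraNT no => gx; apply/existsP; exists x.
      move: cx; rewrite (rooted_edge rt) (negPf xp) andbF /= => /andP [-> /eqP <-].
      by rewrite eqxx.
    have gp : g (par c) = 0.
      move: sum0; rewrite (bigD1 (par c)) /=; last exact: (rooted_parent rt cr).
      by rewrite big1 ?addr0 // => x /andP [cx xp]; exact: gchild.
    have [wp|wp] := eqVneq w (par c); first by rewrite wp gp eqxx in gw.
    by rewrite gchild ?eqxx in gw.
  have [gx0|gx0] := ltP (g x) 0; first by exists g, x; rewrite gv.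
  exists (fun u => - g u), x; rewrite gv oppr0; split=> //.
  by rewrite oppr_lt0 lt_neqAle eq_sym gx.
have child x : e c x -> x != par c -> x != r /\ par x = c.
  move=> cx /negPf xp; move: cx; rewrite (rooted_edge rt) xp andbF /=.
  by case/andP => -> /eqP.
move=> /set2P [cE|cE] cr; rewrite !inE negb_or => /andP [np1 np2].
  have cv : e c v by rewrite cE.
  have [vr vc] : v != r /\ par v = c by apply: child; rewrite // eq_sym.
  by exists g, v; split=> //; rewrite cE ltW.
have cu : e c u by rewrite cE (rooted_sym rt).
have [ur uc] : u != r /\ par u = c by apply: child; rewrite // eq_sym.
by exists (fun u => - g u), u; split=> //; rewrite ?oppr_lt0 // oppr_ge0 cE ltW.
Qed.

End FiedlerChild.

Lemma gdist_ancestor (V : finType) (e : rel V) (r : V) (par : V -> V) (dep : V -> nat) a u :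
  rooted_tree e r par dep -> connected_graph e -> fconnect par u a ->
  (gdist e a u + dep a <= dep u)%N.
Proof.
move=> rt conn; move dE: (dep u) => n; elim: n u dE => [u du ua|n IH u du ua].
  have ur := rooted_dep0 rt du; move: ua; rewrite ur => /(ancestor_root rt) ->.
  by have [_ _ -> _] := rt; rewrite gdist0.
have [<-|ua'] := eqVneq u a; first by rewrite gdist0 du.
have ur : u != r by apply: contra_eq_neq du => ->; have [_ _ -> _] := rt.
move: ua; rewrite ancestorE (negPf ua') /= => pa.
have := IH (par u) _ pa; have := rooted_dep rt ur; rewrite du => -[<-] /(_ erefl).
have := gdist_edge (conn a (par u)) (_ : e (par u) u); rewrite (rooted_sym rt) => /(_ (rooted_parent rt ur)).
by lia.
Qed.

Theorem theorem3p2 (R : realType) (V : finType) (e : rel V)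
    (hT : is_tree e) (hV : (1 < #|V|)%N)
    (S C : {set V}) (hS : spectral_center R e S) (hC : charset R e C)
    (hd : (0 < setdist e S C)%N)
    (s c : V) (hs : s \in S) (hc : c \in C)
    (hsc : gdist e s c = setdist e S C)
    (S' C' : {set pathif_vertex e s c})
    (hS' : spectral_center R (pathif e s c) S')
    (hC' : charset R (pathif e s c) C') :
  (setdist e S C <= setdist (pathif e s c) S' C')%N.
Proof.
have [[syme irre] conn _] := hT.
have rt := tree_rooted s hT; set par := parent e s in rt.
have cs : c != s by apply: contraTneq hd => cE; rewrite -hsc cE gdist0.
have pS x : x \in S -> forall y, y \in C -> (gdist e s c <= gdist e x y)%N.
  by move=> xS y yC; rewrite hsc; exact: setdist_le.
have dc := rooted_dep rt cs.
have pcC : par c \notin C by apply/negP => /(pS s hs); rewrite dc ltnn.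
have cS : c \notin S by apply/negP => /pS /(_ c hc); rewrite gdist0 dc.
have [g [w [eig gc ws wc gw]]] := fiedler_child rt hC hc cs pcC.
have [k [k0 kw kX le_k]] := negative_part_descendants rt eig gc ws wc gw.
have [v1 [cv v1s pv]] := branch_top rt cs.
have v1S : v1 \notin S.
  apply/negP => /pS /(_ c hc); have := gdist_ancestor rt conn cv.
  rewrite (rooted_dep rt v1s); lia.
have /minsetP [/andP [subS /forallP radS] _] := hS.
have dis := subtree_avoids_branch rt cs subS hs cv v1s pv v1S.
have le_B x : (forall u, u \notin branch e s c -> x u = 0) ->
    qform (adjk R e) x <= lambda2 R e * dot x x.
  have /(induced_radiusP syme _ _) [_ leC] := implyP (radS c) cS.
  move=> x0; apply: leC => u uC; apply: x0; apply: contra uC => uB; rewrite inE.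
  have cB : c \in branch e s c by rewrite inE connect0.
  by apply: connect_restrS (branch_connected rt cs cB uB); rewrite -disjoints_subset.
have oldS := spectral_center_old rt cs le_B hS'.
have farC := pathif_charset rt cs k0 kw kX le_k hC'.
have dB := dep_branch rt cs kw kX.
have dV : (setdist e S C <= #|pathif_vertex e s c|)%N.
  by rewrite -hsc card_sum card_ord; apply: leq_trans (ltnW dB) _; exact: leq_addl.
apply: le_setdist => // x y /(subsetP oldS) xW /farC yN.
apply: (le_gdist (f := fun u : pathif_vertex e s c => if u is inr i then i.+1 else 0%N)).
- move=> [a|i] [b|j] //=; first by move=> /andP [_ /eqP ->].
  by case/orP => /eqP => [<-|<-]; [exact: leqnn | exact: (leqW (leqnSn _))].
- exact: dV.
case: x xW => [a|i]; rewrite !inE // => _.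
by case: y yN => [b|j]; rewrite inE //= -leqNgt -hsc.
Qed.
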